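(* Let $f:\mathbb{R}^n\to\mathbb{R}$ be bounded below, $L_0$-Lipschitz and $L_1$-smooth (i.e. differentiable with $L_1$-Lipschitz gradient). For each agent $i\in\{1,\dots,N\}$ and each time step $k$ at which agent $i$ is selected, the asynchronous residual-feedback gradient estimator $G_{\mu_i}(x_k)$ (defined in the context) satisfies $$\mathbb{E}\left[G_{\mu_i}(x_k)\right]=\nabla_i f_{\mu_i}(x_k),$$ where the expectation is over the direction $u_k$, i.e. conditional on $i_k=i$ and on the history before step $k$ (which determines $x_k$ and the previous query value of agent $i$).
   Context: Setting. There are $N$ agents; the joint decision vector is $x=(x^1,\dots,x^N)\in\mathbb{R}^n$, where agent $i$ controls the block $x^i\in\mathbb{R}^{n_i}$, $n=\sum_i n_i$. Agent $i$ has step size $\alpha_i>0$ and smoothing parameter $\mu_i>0$. Asynchrony model. $P=(p_1,\dots,p_N)$ is a fixed probability distribution. At each time step $k=0,1,2,\dots$ one agent $i_k$ is selected, independently of everything before, with $\mathbb{P}(i_k=i)=p_i$. The selected agent queries the (noiseless) value of $f$ once and updates its own block; the other blocks are unchanged. Estimator. Start at a deterministic $x_0\in\mathbb{R}^n$. At step $k$, if $i_k=i$, a vector $u_k\in\mathbb{R}^n$ is drawn, independent of the past, whose $i$-th block is $\mathcal{N}(0,I_{n_i})$ and whose other blocks are zero. The gradient estimate is $$G_{\mu_i}(x_k)=\frac{f(x_k+\mu_i u_k)-f(x_{\ell}+\mu_i u_{\ell})}{\mu_i}\,u_k ,$$ where $\ell<k$ is the (random) most recent time step before $k$ at which agent $i$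 was selected. If agent $i$ has not been selected before step $k$, the previous value is taken to be $f(x_0+\mu_i v_i)$, with $v_i\in\mathbb{R}^n$ an initial direction having $i$-th block $\mathcal{N}(0,I_{n_i})$ and other blocks zero, independent of everything else (and counted as part of the history). The update is $x_{k+1}=x_k-\alpha_i G_{\mu_i}(x_k)$ with $i=i_k$. Smoothed function. $f_{\mu_i}(x)=\mathbb{E}_u[f(x+\mu_i u)]$, where $u\in\mathbb{R}^n$ has $i$-th block $\mathcal{N}(0,I_{n_i})$ and all other blocks zero. Partial gradient. For a differentiable $g:\mathbb{R}^n\to\mathbb{R}$, $\nabla_i g(x)\in\mathbb{R}^n$ is the vector obtained from $\nabla g(x)$ by setting all blocks other than the $i$-th to zero. *)

(* Defs.v *)
From HB Require Import structures.
From mathcomp Require Import all_boot all_order all_algebra.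
From mathcomp Require Import all_classical all_reals all_analysis.

Set Implicit Arguments.
Unset Strict Implicit.
Unset Printing Implicit Defensive.

Import Order.TTheory GRing.Theory Num.Theory.
Import numFieldNormedType.Exports.

Local Open Scope classical_set_scope.
Local Open Scope ring_scope.

(* n_ i is the dimension of block i; block i of x is [submxrow x i]. *)
Notation decision R n_ := 'rV[R]_(\sum_i n_ i)%N.

Section Euclidean.
Context {R : realType}.

(* The library norm on row vectors is the sup norm. *)
Definition enorm m (x : 'rV[R]_m) : R := Num.sqrt (\sum_j x ord0 j ^+ 2).

Definition gradient m (g : 'rV[R]_m -> R) (x : 'rV[R]_m) : 'rV[R]_m :=
  \row_j 'D_(delta_mx ord0 j) g x.

Definition lipschitz_fun m (L : R) (g : 'rV[R]_m -> R) : Prop :=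
  forall x y, `|g x - g y| <= L * enorm (x - y).

Definition smooth_fun m (L : R) (g : 'rV[R]_m -> R) : Prop :=
  (forall x, differentiable g x) /\
  (forall x y, enorm (gradient g x - gradient g y) <= L * enorm (x - y)).

End Euclidean.

Section Blocks.
Context {R : realType} {N : nat} {n_ : 'I_N -> nat}.

Definition block_tuple (i : 'I_N) (x : decision R n_) : (n_ i).-tuple R :=
  [tuple submxrow x i ord0 l | l < n_ i].

(* [nth] is used because block j has type 'rV_(n_ j), not 'rV_(n_ i); only
   the case j = i matters, where [nth 0 t l] is [tnth t l]. *)
Definition embed_block (i : 'I_N) (t : (n_ i).-tuple R) : decision R n_ :=
  \mxrow_j (if j == i then \row_(l < n_ j) nth 0 t l else 0).

Definition partial_gradient (i : 'I_N) (g : decision R n_ -> R)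
    (x : decision R n_) : decision R n_ :=
  \mxrow_j (if j == i then submxrow (gradient g x) j else 0).

End Blocks.

Section Gaussian.
Context {R : realType}.

Definition cons_pair n (xt : measurableTypeR R * n.-tuple (measurableTypeR R)) :
  n.+1.-tuple (measurableTypeR R) := [tuple of xt.1 :: xt.2].

Lemma measurable_cons_pair n : measurable_fun setT (@cons_pair n).
Proof. exact: measurable_cons. Qed.

HB.instance Definition _ n :=
  isMeasurableFun.Build _ _ _ _ (@cons_pair n) (@measurable_cons_pair n).

(* N(0, I_n): the n-fold product of the standard normal law N(0, 1). *)
Fixpoint std_gaussian (n : nat) :
    probability (n.-tuple (measurableTypeR R)) R :=
  match n with
  | 0 => dirac [tuple]
  | n'.+1 => distribution (normal_prob 0 1 \x std_gaussian n')%E (@cons_pair n')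
  end.

End Gaussian.

Section Smoothing.
Context {R : realType} {N : nat} {n_ : 'I_N -> nat}.

Definition smoothed (f : decision R n_ -> R) (mu : R) (i : 'I_N)
    (x : decision R n_) : R :=
  Rintegral (@std_gaussian R (n_ i)) setT
    (fun t => f (x + mu *: embed_block t)).

End Smoothing.

Section Estimator.
Context {R : realType} {N : nat} {n_ : 'I_N -> nat}.
Variables (f : decision R n_ -> R) (mu : 'I_N -> R).

(* All arguments are deterministic here: one realization x, u, v, s of the
   iterates, directions, initial directions and selected agents. *)
Implicit Types (x u : nat -> decision R n_) (v : 'I_N -> decision R n_).
Implicit Types (s : nat -> 'I_N) (i : 'I_N) (k : nat).

(* The largest l < k with s l = i, if any. *)
Definition last_selected s i k : option nat :=
  ohead [seq l <- rev (iota 0 k) | s l == i].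

Definition previous_value x u v s i k : R :=
  if last_selected s i k is Some l then f (x l + mu i *: u l)
  else f (x 0%N + mu i *: v i).

Definition estimator x u v s i k : decision R n_ :=
  ((f (x k + mu i *: u k) - previous_value x u v s i k) / mu i) *: u k.

Definition residual_feedback_iterates (alpha : 'I_N -> R)
    (x0 : decision R n_) x u v s : Prop :=
  x 0%N = x0 /\
  forall k, x k.+1 = x k - alpha (s k) *: estimator x u v s (s k) k.

End Estimator.

Section Probability.
Context {R : realType} {d : measure_display} {Omega : measurableType d}.

Definition coord_events m (X : Omega -> 'rV[R]_m) : set_system Omega :=
  \bigcup_(c in [set: 'I_m])
    preimage_set_system setT (fun w => X w ord0 c : measurableTypeR R)
      measurable.

(* Y is a version of the conditional expectation of the random vector X given
   the event E and the sigma-algebra F, that is, of the conditional expectation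
   given F under P( . | E).  The normalization by P E cancels in the averaging
   identity; if P E = 0 that identity holds trivially. *)
Definition is_cond_expectation m (P : probability Omega R) (E : set Omega)
    (F : set_system Omega) (X Y : Omega -> 'rV[R]_m) : Prop :=
  coord_events Y `<=` F /\
  forall c : 'I_m,
    [/\ P.-integrable E (fun w => (X w ord0 c)%:E),
        P.-integrable E (fun w => (Y w ord0 c)%:E) &
        forall H, F H ->
          (\int[P]_(w in E `&` H) (X w ord0 c)%:E =
           \int[P]_(w in E `&` H) (Y w ord0 c)%:E)%E].

End Probability.

Section Sampling.
Context {R : realType} {d : measure_display} {Omega : measurableType d}.
Context {N : nat} {n_ : 'I_N -> nat}.

(* The sigma-algebra of the history before step k: the initial directions
   together with the agents and directions of the steps m < k. *)
Definition history (s : nat -> Omega -> 'I_N)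
    (u : nat -> Omega -> decision R n_) (v : 'I_N -> Omega -> decision R n_)
    (k : nat) : set_system Omega :=
  <<s (\bigcup_(i in [set: 'I_N]) coord_events (v i)) `|`
      (\bigcup_(m in `I_k)
         (range (fun i => [set w | s m w = i]) `|` coord_events (u m))) >>.

(* Since the history contains the initial directions, the conditions on s and u
   also make the family v independent of all selections and directions. *)
Record async_sampling (P : probability Omega R) (p : 'I_N -> R)
    (s : nat -> Omega -> 'I_N) (u : nat -> Omega -> decision R n_)
    (v : 'I_N -> Omega -> decision R n_) : Prop := AsyncSampling {
  selection_measurable : forall k i, measurable [set w | s k w = i];
  direction_measurable : forall k, coord_events (u k) `<=` measurable;
  initial_measurable : forall i, coord_events (v i) `<=` measurable;

  selection_law : forall k i H, history s u v k H ->
    P (H `&` [set w | s k w = i]) = (P H * (p i)%:E)%E;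

  direction_law : forall k i H (B : set ((n_ i).-tuple (measurableTypeR R))),
    history s u v k H -> measurable B ->
    P (H `&` [set w | s k w = i] `&` [set w | B (block_tuple i (u k w))]) =
    (P (H `&` [set w | s k w = i]) * std_gaussian (n_ i) B)%E;
  direction_support : forall k w j,
    j != s k w -> submxrow (u k w) j = 0;

  initial_law : forall B : forall i, set ((n_ i).-tuple (measurableTypeR R)),
    (forall i, measurable (B i)) ->
    P (\bigcap_(i in [set: 'I_N]) [set w | B i (block_tuple i (v i w))]) =
    (\prod_(i < N) std_gaussian (n_ i) (B i))%E;
  initial_support : forall i w j, j != i -> submxrow (v i w) j = 0
}.

End Sampling.

(* Main.v *)
(* Write [mu], [E] for the smoothing parameter of agent [i] and the embedding of
   block [i].  At a time when agent [i] acts, its direction [E t] is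
   independent of the history, which fixes the current point [x] and the
   previous value [b], so Fubini reduces the conditional expectation to a
   standard Gaussian integral at fixed [x] and [b], namely that of
   [(f (x + mu * E t) - b) / mu * t_l].
   Stein's identity, that [F t * t_l] and [D_l F t] have the same standard
   Gaussian mean, applied to a constant function [F], removes the contribution
   of [b] and, applied to [t |-> f (x + mu * E t)], yields the mean of the
   partial derivative of [f], which is the partial derivative of the smoothed
   function because [f] is smooth.  Integrability of the estimator needs the
   iterates to have finite first moments: by induction on time, a step
   multiplies a history-measurable integrable quantity by an independent
   Gaussian vector, up to an error that the Lipschitz condition makes quadratic
   in that vector. *)

Require Import Defs.
From HB Require Import structures.
From mathcomp Require Import all_boot all_order all_algebra.
From mathcomp Require Import all_classical all_reals all_analysis.
From mathcomp Require Import measurable_realfun ring lra.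

Import Order.TTheory GRing.Theory Num.Theory.
Import numFieldNormedType.Exports.

Local Open Scope classical_set_scope.
Local Open Scope ring_scope.

Set Implicit Arguments.
Unset Strict Implicit.
Unset Printing Implicit Defensive.

(** * Integration against a density *)

Section Density.
Context {R : realType} {d : measure_display} {T : measurableType d}.
Variables (mu nu : {measure set T -> \bar R}) (p : T -> R).
Hypotheses (p_ge0 : forall x, 0 <= p x) (mp : measurable_fun setT p).
Hypothesis nuE : forall A, measurable A -> nu A = (\int[mu]_(x in A) (p x)%:E)%E.

Import HBNNSimple.

(** By linearity it suffices to treat the indicator of a level set, where the claim is the
    hypothesis [nuE]. *)
Let integral_density_nnsfun (h : {nnsfun T >-> R}) :
  (\int[nu]_x (h x)%:E = \int[mu]_x ((h x)%:E * (p x)%:E))%E.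
Proof.
under [LHS]eq_integral do rewrite fimfunE -fsumEFin//.
rewrite [LHS]ge0_integral_fsum//; last 2 first.
  - by move=> r; exact/measurable_EFinP/measurableT_comp.
  - by move=> n x _; rewrite EFinM nnfun_muleindic_ge0.
under [RHS]eq_integral.
  move=> x xD; rewrite fimfunE -fsumEFin// muleC ge0_mule_fsumr; last first.
    by move=> r; rewrite EFinM nnfun_muleindic_ge0.
  over.
rewrite [RHS]ge0_integral_fsum//; last 2 first.
  - move=> r; apply: emeasurable_funM; first exact/measurable_EFinP.
    by apply/measurable_EFinP/measurableT_comp.
  - move=> n x _; rewrite EFinM mule_ge0//; last by rewrite nnfun_muleindic_ge0.
    by rewrite lee_fin.
apply: eq_fsbigr => r rh.
rewrite integralZl_indic_nnsfun// integral_indic//= setIT nuE//.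
under [RHS]eq_integral do rewrite EFinM muleCA.
rewrite ge0_integralZl//.
- rewrite [in LHS]integral_mkcond; congr (_ * _)%E.
  apply: eq_integral => x _; rewrite patchE indicE.
  by case: ifPn => _; rewrite ?mule1 ?mule0.
- by apply: emeasurable_funM; exact/measurable_EFinP.
- by move=> x _; rewrite mule_ge0 ?lee_fin ?p_ge0.
- by move: rh; rewrite inE => -[t _ <-]; rewrite lee_fin.
Qed.

(** Monotone convergence along increasing simple approximations, applied on both sides; multiplying
    by [p >= 0] keeps the sequence increasing. *)
Lemma ge0_integral_density (f : T -> \bar R) :
  measurable_fun setT f -> (forall x, 0 <= f x)%E ->
  (\int[nu]_x f x = \int[mu]_x (f x * (p x)%:E))%E.
Proof.
move=> mf f0.
pose h := nnsfun_approx measurableT mf.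
have hf x : (h n x)%:E @[n --> \oo] --> f x by exact: cvg_nnsfun_approx.
transitivity (limn (fun n => \int[nu]_x (h n x)%:E)%E).
  rewrite -monotone_convergence//=.
  - by apply: eq_integral => x _; apply/esym/cvg_lim => //; exact: hf.
  - by move=> n; exact/measurable_EFinP.
  - by move=> n x _; rewrite lee_fin.
  - by move=> x _ a b ab; rewrite lee_fin; exact/lefP/nd_nnsfun_approx.
rewrite (_ : (fun n => _) = fun n =>
  (\int[mu]_x ((h n x)%:E * (p x)%:E))%E); last first.
  by apply/funext => n; exact: integral_density_nnsfun.
rewrite -monotone_convergence//=.
- apply: eq_integral => x _; apply/cvg_lim => //.
  by apply: cvgeZr => //; exact: hf.
- by move=> n; apply: emeasurable_funM; exact/measurable_EFinP.
- by move=> n x _; rewrite mule_ge0// lee_fin.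
- move=> x _ a b ab; apply: lee_wpmul2r; rewrite lee_fin//.
  exact/lefP/nd_nnsfun_approx.
Qed.

Lemma integrable_density (f : T -> R) : measurable_fun setT f ->
  mu.-integrable setT (fun x => (f x * p x)%:E) ->
  nu.-integrable setT (EFin \o f).
Proof.
move=> mf /integrableP[_ fpoo]; apply/integrableP; split.
  exact/measurable_EFinP.
rewrite ge0_integral_density//; last by do 2 apply: measurableT_comp => //.
apply: le_lt_trans fpoo; rewrite le_eqVlt; apply/predU1l.
by apply: eq_integral => x _ /=; rewrite normrM (ger0_norm (p_ge0 x)) EFinM.
Qed.

(** As the density is nonnegative, multiplying by it commutes with positive and negative parts, so
    the two sides agree part by part, even when these are infinite. *)
Lemma integral_density (f : T -> R) : measurable_fun setT f ->
  (\int[nu]_x (f x)%:E = \int[mu]_x (f x * p x)%:E)%E.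
Proof.
move=> mf; rewrite [LHS]integralE [RHS]integralE.
have mEf : measurable_fun setT (EFin \o f) by exact/measurable_EFinP.
rewrite ge0_integral_density//; last exact: measurable_funepos.
rewrite ge0_integral_density//; last exact: measurable_funeneg.
congr (_ - _)%E; apply: eq_integral => x _.
- rewrite !funeposE/= -!EFin_max -EFinM; congr (_%:E).
  by rewrite maxr_pMl// mul0r.
- rewrite !funenegE/= -!EFin_max -EFinM; congr (_%:E).
  by rewrite maxr_pMl// mul0r mulNr.
Qed.

End Density.

(** * Stein's identity for the standard normal law *)

Section StandardNormal.
Context {R : realType}.
Local Notation lambda := (@lebesgue_measure R).
Local Notation pdf := (@normal_pdf R 0 1).

Let pdfE x : pdf x = normal_peak 1 * expR (- (x ^+ 2 / 2)).
Proof.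
rewrite normal_pdfE ?oner_neq0// /normal_fun subr0 expr1n.
by rewrite mulNr.
Qed.

Lemma is_derive_std_normal_pdf (x : R) : is_derive x 1 pdf (- x * pdf x).
Proof.
rewrite (_ : (pdf : R -> R) =
    (fun y => normal_peak 1 * expR (- (y ^+ 2 / 2)))); last first.
  by apply/funext => y; exact: pdfE.
have h1 : is_derive x 1 (fun y : R => - (y ^+ 2 / 2)) (- x).
  apply: is_derive_eq.
  by rewrite /GRing.scale/=; field.
have h2 : is_derive x 1 (fun y : R => expR (- (y ^+ 2 / 2)))
    (- x * expR (- (x ^+ 2 / 2))).
  rewrite mulrC; exact: (@is_derive1_comp _ expR (fun y : R => - (y ^+ 2 / 2))).
apply: is_derive_eq.
by rewrite /GRing.scale/=; ring.
Qed.

(** Split [exp (- x^2 / 2)] into two factors [exp (- x^2 / 4)]: one absorbs the quadratic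
    polynomial, the other is, up to its peak, the normal density of variance 2. Quadratic growth is
    thereby dominated by an integrable density. *)
Lemma std_normal_pdf_decay (x : R) :
  (1 + x ^+ 2) * pdf x <=
  4 * normal_peak 1 / normal_peak (Num.sqrt 2) * normal_pdf 0 (Num.sqrt 2) x.
Proof.
have s0 : Num.sqrt (2 : R) != 0 by rewrite sqrtr_eq0 -ltNge.
rewrite pdfE normal_pdfE// /normal_fun subr0 sqr_sqrtr//.
rewrite mulrA divfK ?gt_eqF ?normal_peak_gt0//.
have -> : - x ^+ 2 / (2 *+ 2) = - (x ^+ 2 / 4) :> R by rewrite mulNr -mulr_natr -natrM.
have -> : - (x ^+ 2 / 2) = - (x ^+ 2 / 4) + - (x ^+ 2 / 4) :> R by field.
rewrite expRD; set e := expR _.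
(* From [1 + y <= exp y] at [y = x^2 / 4], which gives [4 + x^2 <= 4 * exp (x^2 / 4)]. *)
have he : (1 + x ^+ 2) * e <= 4.
  rewrite /e expRN ler_pdivrMr ?expR_gt0//.
  by have := expR_ge1Dx (x ^+ 2 / 4); nra.
have ce0 : 0 <= normal_peak 1 * e by rewrite mulr_ge0 ?normal_peak_ge0 ?expR_ge0.
by have := ler_wpM2l ce0 he; nra.
Qed.

(** The variance 2 density is at most its peak, which cancels. This bound controls the boundary
    terms in the integration by parts. *)
Lemma std_normal_pdf_ub (x : R) : (1 + x ^+ 2) * pdf x <= 4 * normal_peak 1.
Proof.
apply: le_trans (std_normal_pdf_decay x) _.
have s0 : Num.sqrt (2 : R) != 0 by rewrite sqrtr_eq0 -ltNge.
have p0 := normal_peak_gt0 s0.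
rewrite -[leRHS](@divfK _ (normal_peak (Num.sqrt 2))) ?gt_eqF//.
by rewrite ler_wpM2l ?normal_pdf_ub// !mulr_ge0 ?invr_ge0 ?normal_peak_ge0.
Qed.

Lemma integrable_std_normal_pdf (g : R -> R) (K : R) : measurable_fun setT g ->
  (forall x, `|g x| <= K * (1 + x ^+ 2)) ->
  lambda.-integrable setT (fun x => (g x * pdf x)%:E).
Proof.
move=> mg gK.
have K0 : 0 <= K by move: (gK 0); rewrite expr0n addr0 mulr1; exact: le_trans.
pose C := K * (4 * normal_peak 1 / normal_peak (Num.sqrt 2)).
have := @integrable_normal_pdf R 0 (Num.sqrt 2).
move=> /(@integrableZl _ _ _ _ _ measurableT C).
apply: le_integrable => //.
  apply/measurable_EFinP/measurable_funM => //; exact: measurable_normal_pdf.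
move=> x _; rewrite -EFinM !abse_EFin lee_fin.
apply: le_trans (ler_norm _).
rewrite normrM (ger0_norm (normal_pdf_ge0 _ _ _)).
apply: le_trans (ler_wpM2r (normal_pdf_ge0 _ _ _) (gK x)) _.
by rewrite /C -!mulrA ler_wpM2l// !mulrA std_normal_pdf_decay.
Qed.

Lemma integrable_std_normal (g : R -> R) (K : R) : measurable_fun setT g ->
  (forall x, `|g x| <= K * (1 + x ^+ 2)) ->
  (normal_prob 0 1).-integrable setT (EFin \o g).
Proof.
move=> mg gK.
apply: (@integrable_density _ _ _ lambda (normal_prob 0 1) pdf) => //.
- exact: normal_pdf_ge0.
- exact: measurable_normal_pdf.
exact: integrable_std_normal_pdf gK.
Qed.

(** The fundamental theorem of calculus on [[-(n+1), n+1]] leaves two boundary values of [H], each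
    at most [K / (n+1)] in absolute value; dominated convergence, with [|h|] as dominating function,
    carries the integrals to the whole line. *)
Lemma integral_derive_eq0 (H h : R -> R) (K : R) :
  (forall x : R, is_derive x 1 H (h x)) -> continuous h ->
  lambda.-integrable setT (EFin \o h) ->
  (forall x, `|H x| * (1 + `|x|) <= K) ->
  (\int[lambda]_x (h x)%:E = 0)%E.
Proof.
move=> dH ch ih HK.
have cH : continuous H.
  by move=> x; apply/differentiable_continuous/derivable1_diffP; case: (dH x).
pose I n := [set` `[- n.+1%:R, n.+1%:R : R]].
have mI n : measurable (I n) by exact: measurable_itv.
have intI n : (\int[lambda]_(x in I n) (h x)%:E =
    (H n.+1%:R)%:E - (H (- n.+1%:R))%:E)%E.
  apply: continuous_FTC2.
  - by rewrite -subr_gt0 opprK addr_gt0.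
  - exact: continuous_subspaceT.
  - split.
    + by move=> x _; case: (dH x).
    + by apply: cvg_at_right_filter; exact: cH.
    + by apply: cvg_at_left_filter; exact: cH.
  - by move=> x _; rewrite derive1E derive_val.
have : (\int[lambda]_x ((EFin \o h) \_ (I n)) x)%E @[n --> \oo] -->
    (\int[lambda]_x (h x)%:E)%E.
  apply: (@dominated_cvg _ _ _ lambda setT measurableT
    (fun n => (EFin \o h) \_ (I n)) (EFin \o h) (fun x => `|h x|%:E)) => //.
  - move=> n; apply/(measurable_restrictT _ (mI n))/measurable_funTS.
    exact: measurable_int ih.
  - move=> x _; apply: cvg_near_cst.
    near=> n; rewrite patchE mem_set// /I/= in_itv/= -ler_norml.
    near: n; exists (Num.truncn `|x|) => // n /= nx.
    apply/ltW/(lt_le_trans (truncnS_gt _)); rewrite ler_nat; exact: leq_trans nx _.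
  - exact: integrable_norm.
  - move=> n x _; rewrite patchE; case: ifPn => _ //=.
    by rewrite [X in (X <= _)%E]abse0 lee_fin.
set s := (X in X @ _).
have -> : s = fun n => (H n.+1%:R - H (- n.+1%:R))%:E.
  by apply/funext => n; rewrite /s -integral_mkcond/= intI EFinB.
move=> /cvg_lim <-//; apply/cvg_lim => //.
apply/cvg_EFin; first by near=> n.
have K0 : 0 <= K.
  by apply: le_trans (HK 0); rewrite mulr_ge0// addr_ge0.
have HK0 (u : nat -> R) : (forall n, `|u n| = n.+1%:R) ->
    H (u n) @[n --> \oo] --> 0.
  move=> un; apply/norm_cvg0P.
  apply: (@squeeze_cvgr _ _ _ _ (cst 0) (fun n => K * harmonic n)).
  - near=> n; rewrite normr_ge0/= /harmonic/= ler_pdivlMr//.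
    by apply: le_trans (HK (u n)); rewrite un ler_wpM2l// lerDr.
  - exact: cvg_cst.
  - by rewrite -(mulr0 K); apply: cvgM; [exact: cvg_cst|exact: cvg_harmonic].
rewrite -(subr0 (0 : R)) /=; apply: cvgB; apply: HK0 => n.
- by rewrite ger0_norm.
- by rewrite normrN ger0_norm.
Unshelve. all: by end_near. Qed.

(* [g x * x * pdf x - g' x * pdf x] is the derivative of [- g * pdf], which
   vanishes at infinity. *)
Lemma stein_normal (g g' : R -> R) (K : R) :
  (forall x : R, is_derive x 1 g (g' x)) -> continuous g' ->
  (forall x, `|g x| <= K * (1 + `|x|)) -> (forall x, `|g' x| <= K) ->
  (\int[normal_prob 0 1]_x (g x * x)%:E = \int[normal_prob 0 1]_x (g' x)%:E)%E.
Proof.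
move=> dg cg' gK g'K.
have cg : continuous g.
  by move=> x; apply/differentiable_continuous/derivable1_diffP; case: (dg x).
have mg : measurable_fun setT g by exact: continuous_measurable_fun.
have mg' : measurable_fun setT g' by exact: continuous_measurable_fun.
have mgx : measurable_fun setT (fun x => g x * x) by exact: measurable_funM.
have K0 : 0 <= K by exact: le_trans (g'K 0).
have igx : lambda.-integrable setT (fun x => (g x * x * pdf x)%:E).
  apply: (@integrable_std_normal_pdf _ (2 * K)) => // x.
  rewrite normrM; apply: le_trans (ler_wpM2r (normr_ge0 x) (gK x)) _.
  rewrite -(real_normK (num_real x)); have := normr_ge0 x; set y := `|x| => y0.
  have h : (1 + y) * y <= 2 * (1 + y ^+ 2) by nra.
  by have := ler_wpM2l K0 h; nra.
have ig' : lambda.-integrable setT (fun x => (g' x * pdf x)%:E).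
  apply: (@integrable_std_normal_pdf _ K) => // x.
  by apply: le_trans (g'K x) _; rewrite ler_peMr// lerDl sqr_ge0.
have NE := @integral_density _ _ _ lambda (normal_prob 0 1) pdf
  (normal_pdf_ge0 0 1) (measurable_normal_pdf 0 1) (fun _ _ => erefl).
rewrite (NE _ mgx) (NE _ mg').
have fin1 := integrable_fin_num measurableT igx.
have fin2 := integrable_fin_num measurableT ig'.
apply/eqP; rewrite -[X in _ == X]add0e -sube_eq ?fin_num_adde_defl//.
rewrite -integralB_EFin//; apply/eqP.
under eq_integral do rewrite -EFinB.
have pc := @continuous_normal_pdf R 0 1 (oner_neq0 _).
(* The constant combines [|g x| <= K (1 + |x|)], [(1 + |x|)^2 <= 2 (1 + x^2)] and
   [(1 + x^2) * pdf x <= 4 * normal_peak 1]. *)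
apply: (@integral_derive_eq0 (fun x => - (g x * pdf x)) _ (8 * K * normal_peak 1)).
- move=> x; have dp := is_derive_std_normal_pdf x.
  have := dg x => dgx.
  apply: is_derive_eq.
  by rewrite /GRing.scale/=; ring.
- move=> x; apply: cvgB; apply: cvgM; try exact: pc; last exact: cg'.
  by apply: cvgM; [exact: cg|exact: cvg_id].
- by have := integrableB measurableT igx ig'.
- move=> x; rewrite normrN normrM (ger0_norm (normal_pdf_ge0 _ _ _)) mulrAC.
  have := std_normal_pdf_ub x; have := gK x; have := normal_pdf_ge0 0 1 x.
  rewrite -(real_normK (num_real x)); have := normr_ge0 x.
  set y := `|x|; set p := pdf x; set c := normal_peak 1; set G := `|g x|.
  move=> y0 p0 GK pc'.
  have h1 : (1 + y) * (1 + y) <= 2 * (1 + y ^+ 2).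
    by have := sqr_ge0 (y - 1); nra.
  have y1 : 0 <= 1 + y by rewrite addr_ge0.
  have h2 := ler_wpM2r p0 (ler_wpM2r y1 GK).
  have h3 := ler_wpM2l K0 (ler_wpM2r p0 h1).
  have h4 := ler_wpM2l K0 pc'.
  by nra.
Qed.

End StandardNormal.

(** * Stein's identity for standard Gaussian tuples *)

Lemma integral_probability_cst (R : realType) d (T : measurableType d)
  (P : probability T R) (c : \bar R) : (\int[P]_x c = c)%E.
Proof. by rewrite integral_cst// [X in (_ * X)%E]probability_setT mule1. Qed.

Section GaussianTuples.
Context {R : realType}.
Local Notation TR := (measurableTypeR R).
Local Notation N01 := (@normal_prob R 0 1).
Local Notation gauss := (@std_gaussian R).

(** The coordinate line through [t]: the partial derivative of [F] in coordinate [l] is the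
    derivative of [fun a => F (replace_tnth l t a)]. *)
Definition replace_tnth n (l : 'I_n) (t : n.-tuple R) (a : R) : n.-tuple R :=
  [tuple if j == l then a else tnth t j | j < n].

Let cons_tup n (a : R) (t : n.-tuple R) : n.+1.-tuple R := [tuple of a :: t].

Lemma replace_tnth0 n (t : n.-tuple R) (a b : R) :
  replace_tnth ord0 (cons_tup b t) a = cons_tup a t.
Proof.
apply: eq_from_tnth => j; rewrite tnth_mktuple.
by case: (unliftP ord0 j) => [k ->|->]; rewrite ?eqxx ?tnth0// !tnthS.
Qed.

Lemma replace_tnthS n (l : 'I_n) (t : n.-tuple R) (a b : R) :
  replace_tnth (lift ord0 l) (cons_tup b t) a = cons_tup b (replace_tnth l t a).
Proof.
apply: eq_from_tnth => j; rewrite tnth_mktuple.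
case: (unliftP ord0 j) => [k ->|->]; rewrite ?tnth0//.
by rewrite !tnthS tnth_mktuple (inj_eq lift_inj).
Qed.

Lemma ge0_integral_gaussianS n (f : n.+1.-tuple TR -> \bar R) :
  measurable_fun setT f -> (forall t, 0 <= f t)%E ->
  (\int[gauss n.+1]_t f t = \int[N01 \x gauss n]_z f (cons_pair z))%E.
Proof.
move=> mf f0; rewrite /= ge0_integral_distribution//.
Qed.

Lemma integrable_gaussianS n (f : n.+1.-tuple TR -> R) :
  (gauss n.+1).-integrable setT (EFin \o f) ->
  (N01 \x gauss n)%E.-integrable setT (fun z => (f (cons_pair z))%:E).
Proof.
move=> /integrableP[mf fi]; apply/integrableP; split.
  exact: (measurableT_comp mf (@measurable_cons_pair R n)).
move: fi; rewrite ge0_integral_gaussianS//.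
exact: measurableT_comp.
Qed.

Lemma integral_gaussianS n (f : n.+1.-tuple TR -> R) :
  (gauss n.+1).-integrable setT (EFin \o f) ->
  (\int[gauss n.+1]_t (f t)%:E = \int[N01 \x gauss n]_z (f (cons_pair z))%:E)%E.
Proof.
move=> fi; rewrite /= integral_distribution//; last exact: integrable_gaussianS.
exact: measurable_int fi.
Qed.

(** Each marginal of the product law is standard normal: Tonelli peels off the first coordinate, and
    the factor on which [h] does not depend has mass 1. *)
Lemma ge0_integral_gaussian_coord n (j : 'I_n) (h : R -> \bar R) :
  measurable_fun setT h -> (forall x, 0 <= h x)%E ->
  (\int[gauss n]_t h (tnth t j) = \int[N01]_x h x)%E.
Proof.
elim: n j => [[]//|n IHn] j mh h0.
have mhj m (i : 'I_m) : measurable_fun setT (fun t : m.-tuple TR => h (tnth t i)).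
  by apply: measurableT_comp => //; exact: measurable_tnth.
rewrite ge0_integral_gaussianS// fubini_tonelli1//; last first.
  exact: (measurableT_comp (mhj _ j) (@measurable_cons_pair R n)).
rewrite /fubini_F/=; case: (unliftP ord0 j) => [k|] ->.
- under eq_integral do under eq_integral do rewrite tnthS.
  under eq_integral do rewrite IHn//.
  exact: (integral_probability_cst N01).
- apply: eq_integral => x _; under eq_integral do rewrite tnth0.
  by rewrite /= (integral_probability_cst (gauss n)).
Qed.

Lemma integrable_gaussian_coord n (j : 'I_n) (h : R -> R) (K : R) :
  measurable_fun setT h -> (forall x, `|h x| <= K * (1 + x ^+ 2)) ->
  (gauss n).-integrable setT (fun t => (h (tnth t j))%:E).
Proof.
move=> mh hK; have /integrableP[_ hi] := integrable_std_normal mh hK.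
apply/integrableP; split.
  apply/measurable_EFinP/measurableT_comp => //; exact: measurable_tnth.
rewrite (@ge0_integral_gaussian_coord _ _ (fun x => `|(h x)%:E|%E))//.
by apply: measurableT_comp => //; exact/measurable_EFinP.
Qed.

Lemma integrable_gaussian n (f : n.-tuple TR -> R) (K : R) :
  measurable_fun setT f ->
  (forall t, `|f t| <= K * (1 + \sum_(j < n) tnth t j ^+ 2)) ->
  (gauss n).-integrable setT (EFin \o f).
Proof.
move=> mf fK.
have : (gauss n).-integrable setT
    (fun t => (K * (1 + \sum_(j < n) tnth t j ^+ 2))%:E).
  under eq_fun do rewrite EFinM.
  apply: integrableZl => //; under eq_fun do rewrite EFinD.
  apply: integrableD => //; first exact: finite_measure_integrable_cst.
  under eq_fun do rewrite -sumEFin.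
  apply: integrable_sum => // j _.
  apply: (@integrable_gaussian_coord _ _ (fun x => x ^+ 2) 1) => [|x].
    exact: measurable_funX.
  by rewrite ger0_norm ?sqr_ge0// mul1r lerDr.
apply: le_integrable => //; first exact/measurable_EFinP.
move=> t _; rewrite !abse_EFin lee_fin.
exact: le_trans (fK t) (ler_norm _).
Qed.

Lemma integrable_gaussian_mul n (l : 'I_n) (F : n.-tuple TR -> R) (K : R) :
  measurable_fun setT F ->
  (forall t, `|F t| <= K * (1 + \sum_(j < n) `|tnth t j|)) ->
  (gauss n).-integrable setT (fun t => (F t * tnth t l)%:E).
Proof.
move=> mF FK.
have K0 : 0 <= K.
  have := le_trans (normr_ge0 _) (FK [tuple 0 | _ < n]).
  by rewrite pmulr_lge0// ltr_pwDl// sumr_ge0.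
(* After multiplication by [tnth t l] there are [n.+1] terms, [|t_l|] and the [n] products
   [|t_j| * |t_l|], each at most [1 + S] with [S] the sum of the squares. *)
apply: (@integrable_gaussian _ _ (K * n.+1%:R)).
  by apply: measurable_funM => //; exact: measurable_tnth.
move=> t; rewrite normrM.
apply: le_trans (ler_wpM2r (normr_ge0 _) (FK t)) _.
rewrite -!mulrA ler_wpM2l// mulrDl mul1r mulr_suml.
set S := \sum_(j < n) tnth t j ^+ 2.
have tS j : `|tnth t j| ^+ 2 <= S.
  rewrite real_normK ?num_real// /S (bigD1 j)//= lerDl.
  by rewrite sumr_ge0// => k _; exact: sqr_ge0.
have h j : `|tnth t j| * `|tnth t l| <= 1 + S.
  have := tS j; have := tS l; have := sqr_ge0 (`|tnth t j| - `|tnth t l|).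
  by nra.
have hl : `|tnth t l| <= 1 + S.
  by have := tS l; have := sqr_ge0 (`|tnth t l| - 1); nra.
have : \sum_(j < n) `|tnth t j| * `|tnth t l| <= \sum_(j < n) (1 + S).
  by apply: ler_sum => j _; exact: h.
rewrite sumr_const card_ord -(mulr_natl (1 + S)).
have -> : n.+1%:R = 1 + n%:R :> R by rewrite -(natrD _ 1 n).
by move=> h'; rewrite mulrDl mul1r lerD.
Qed.

(** Induction on the dimension through Fubini. Either [l] is the first coordinate and the
    one-dimensional identity applies with the others frozen, or the first coordinate is frozen and
    the induction hypothesis applies to the section. *)
Lemma stein_gaussian n (l : 'I_n) (F F' : n.-tuple TR -> R) (K : R) :
  measurable_fun setT F -> measurable_fun setT F' ->
  (forall (t : n.-tuple R) (b : R),
    is_derive b 1 (fun a => F (replace_tnth l t a)) (F' (replace_tnth l t b))) ->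
  (forall t : n.-tuple R, continuous (fun a => F' (replace_tnth l t a))) ->
  (forall t, `|F t| <= K * (1 + \sum_(j < n) `|tnth t j|)) ->
  (forall t, `|F' t| <= K) ->
  (\int[gauss n]_t (F t * tnth t l)%:E = \int[gauss n]_t (F' t)%:E)%E.
Proof.
elim: n l F F' K => [[]//|n IHn] l F F' K mF mF' dF cF' FK F'K.
have K0 : 0 <= K by exact: le_trans (F'K [tuple 0 | _ < n.+1]).
have iF : (gauss n.+1).-integrable setT (fun t => (F t * tnth t l)%:E).
  exact: integrable_gaussian_mul FK.
have iF' : (gauss n.+1).-integrable setT (fun t => (F' t)%:E).
  apply: (@integrable_gaussian _ _ K) => // t.
  apply: le_trans (F'K t) _; rewrite ler_peMr// lerDl.
  by rewrite sumr_ge0// => j _; exact: sqr_ge0.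
have consE (a : R) (t : n.-tuple R) : cons_pair (a, t) = cons_tup a t by [].
have mcons (a : R) : measurable_fun setT (fun t : n.-tuple TR => cons_pair (a, t)).
  exact: (measurableT_comp (@measurable_cons_pair R n) (pair1_measurable a)).
have sumE (a : R) (t : n.-tuple R) :
    \sum_(j < n.+1) `|tnth (cons_tup a t) j| = `|a| + \sum_(j < n) `|tnth t j|.
  rewrite big_ord_recl tnth0; congr (_ + _).
  by apply: eq_bigr => j _; rewrite tnthS.
have bound (a : R) (t : n.-tuple R) :
    `|F (cons_tup a t)| <=
    K * ((1 + `|a|) * (1 + \sum_(j < n) `|tnth t j|)).
  apply: le_trans (FK _) _; rewrite sumE ler_wpM2l//.
  have : 0 <= \sum_(j < n) `|tnth t j| by rewrite sumr_ge0.
  by have := normr_ge0 a; nra.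
rewrite (integral_gaussianS iF) (integral_gaussianS iF').
case: (unliftP ord0 l) => [k|] lE; subst l.
- rewrite -integral12_prod_meas1; last exact: (integrable_gaussianS iF).
  rewrite -integral12_prod_meas1; last exact: (integrable_gaussianS iF').
  apply: eq_integral => a _; rewrite /fubini_F.
  under eq_integral do rewrite consE tnthS.
  apply: (IHn k (fun t => F (cons_tup a t)) (fun t => F' (cons_tup a t))
    (K * (1 + `|a|))).
  + exact: (measurableT_comp mF (mcons a)).
  + exact: (measurableT_comp mF' (mcons a)).
  + move=> t b; have := dF (cons_tup a t) b; rewrite replace_tnthS.
    by under [X in is_derive _ _ X _ -> _]eq_fun do rewrite replace_tnthS.
  + move=> t; have := cF' (cons_tup a t).
    by under [X in continuous X -> _]eq_fun do rewrite replace_tnthS.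
  + by move=> t; rewrite -mulrA.
  + by move=> t; apply: le_trans (F'K _) _; rewrite ler_peMr// lerDl.
(* Here the first coordinate must be the inner variable, so the order of integration is the opposite
   of the previous case. *)
- rewrite -integral21_prod_meas1; last exact: (integrable_gaussianS iF).
  rewrite -integral21_prod_meas1; last exact: (integrable_gaussianS iF').
  apply: eq_integral => t _; rewrite /fubini_G.
  under eq_integral do rewrite consE tnth0.
  pose S := \sum_(j < n) `|tnth t j|.
  have S0 : 0 <= S by rewrite sumr_ge0.
  apply: (@stein_normal _ (fun a => F (cons_tup a t))
    (fun a => F' (cons_tup a t)) (K * (1 + S))).
  + move=> b; have := dF (cons_tup 0 t) b; rewrite replace_tnth0.
    by under [X in is_derive _ _ X _ -> _]eq_fun do rewrite replace_tnth0.
  + have := cF' (cons_tup 0 t).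
    by under [X in continuous X -> _]eq_fun do rewrite replace_tnth0.
  + by move=> a; apply: le_trans (bound a t) _; rewrite mulrA mulrAC.
  + by move=> a; apply: le_trans (F'K _) _; rewrite ler_peMr// lerDl.
Qed.

End GaussianTuples.

(** * Measurability of continuous functions of random vectors *)

Section VectorMeasurability.
Context {R : realType}.

Lemma rat_row_approx m (x : 'rV[R]_m) (e : R) : 0 < e ->
  exists q : 'rV[rat]_m, forall j, `|x ord0 j - ratr (q ord0 j)| < e.
Proof.
move=> e0.
have h j : exists q : rat, `|x ord0 j - ratr q| < e.
  have /rat_in_itvoo[q] : x ord0 j - e < x ord0 j + e.
    by lra.
  rewrite in_itv/= => /andP[xq qx]; exists q.
  by rewrite ltr_norml; apply/andP; split; lra.
have [q qP] := choice h.
by exists (\row_j q j) => j; rewrite mxE.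
Qed.

(* Rational boxes form a countable base of the topology of ['rV[R]_m]. *)
Lemma continuous_measurable_rV d (T : measurableType d) m
    (X : T -> 'rV[R]_m) (f : 'rV[R]_m -> R) :
  (forall j, measurable_fun setT (fun w => X w ord0 j)) -> continuous f ->
  measurable_fun setT (fun w => f (X w)).
Proof.
move=> mX cf mT; apply: (measurability _ (RGenOInfty.measurableE R)) => //.
move=> /= _ [_ [a ->] <-]; rewrite setTI.
pose box (q : 'rV[rat]_m) (n : nat) :=
  [set x : 'rV[R]_m | forall j, `|x ord0 j - ratr (q ord0 j)| < n.+1%:R^-1].
(* The set where [f > a] is open, hence the union of the rational boxes contained in it; its
   preimage is then a countable union of preimages of boxes. *)
pose A (qn : 'rV[rat]_m * nat) :=
  [set w | box qn.1 qn.2 (X w) /\ box qn.1 qn.2 `<=` [set x | a < f x]].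
rewrite (_ : _ @^-1` _ = \bigcup_qn A qn).
  apply: countable_bigcupT_measurable; first exact: countableP.
  move=> [q n].
  have [sub|nsub] := pselect (box q n `<=` [set x | a < f x]); last first.
    rewrite (_ : A _ = set0) ?measurable0//.
    by apply/seteqP; split => // w [].
  rewrite (_ : A _ = \bigcap_(j in [set: 'I_m])
      ((fun w => X w ord0 j - ratr (q ord0 j)) @^-1`
         [set` `]- n.+1%:R^-1, n.+1%:R^-1[ ])).
    apply: fin_bigcap_measurable => // j _.
    rewrite -[X in measurable X]setTI.
    apply: measurable_funB => //.
  apply/seteqP; split => [w [wb _] j _|w wb].
    by rewrite /= in_itv/= -ltr_norml.
  by split => // j; have := wb j I; rewrite /= in_itv/= -ltr_norml.
apply/seteqP; split => [w|w [qn _ [wb]]]; last first.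
  by move=> /(_ _ wb)/=; rewrite in_itv/= andbT.
rewrite /= in_itv/= andbT => afw.
have /nbhs_ballP[e /= e0 eb] : nbhs (X w) [set x | a < f x].
  exact: (cvgr_gt (f (X w)) (cf (X w)) a afw).
(* Both [X w] and any [x] in the box are within [1 / (n+1)] of the rational centre, so half of [e]
   keeps the box inside the ball around [X w]. *)
have [n ne] : exists n, (n.+1%:R^-1 : R) < e / 2.
  exists (Num.truncn (e / 2)^-1).
  by rewrite invf_plt ?posrE ?divr_gt0// truncnS_gt.
have [q qP] : exists q, box q n (X w) by apply: rat_row_approx; rewrite invr_gt0.
exists (q, n) => //; split => //= x xb.
apply: eb; split => // i j; rewrite (_ : i = ord0) ?/ball/=; last exact: ord1.
apply: le_lt_trans (ler_distD (ratr (q ord0 j)) _ _) _.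
rewrite (splitr e) ltrD//; first exact: lt_trans (qP j) ne.
by rewrite distrC; exact: lt_trans (xb j) ne.
Qed.

End VectorMeasurability.

(** * First-order calculus on row vectors *)

Section EuclideanBounds.
Context {R : realType} {m : nat}.
Implicit Types (x y z h : 'rV[R]_m) (g : 'rV[R]_m -> R).

(** The l1 norm dominates [enorm], so Lipschitz bounds carry over to it, and being a sum over
    coordinates it is integrable as soon as they are. *)
Definition norm1 x : R := \sum_j `|x ord0 j|.

Lemma norm1_ge0 x : 0 <= norm1 x.
Proof. by rewrite sumr_ge0. Qed.

Lemma norm1Z (a : R) x : norm1 (a *: x) = `|a| * norm1 x.
Proof. by rewrite mulr_sumr; apply: eq_bigr => j _; rewrite mxE normrM. Qed.

Lemma norm1_delta j : norm1 (delta_mx ord0 j) = 1.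
Proof.
rewrite /norm1 (bigD1 j)//= mxE !eqxx normr1 big1 ?addr0// => k kj.
by rewrite mxE (negbTE kj) andbF normr0.
Qed.

Lemma sum_delta_mx (a : 'I_m -> R) j :
  \sum_k (delta_mx ord0 j : 'rV[R]_m) ord0 k * a k = a j.
Proof.
rewrite (bigD1 j)//= big1 => [|k kj]; first by rewrite mxE !eqxx mul1r addr0.
by rewrite mxE (negbTE kj) andbF mul0r.
Qed.

Lemma coord_le_enorm x j : `|x ord0 j| <= enorm x.
Proof.
rewrite -sqrtr_sqr ler_wsqrtr// (bigD1 j)//= lerDl.
by rewrite sumr_ge0// => k _; exact: sqr_ge0.
Qed.

Lemma enorm_le_norm1 x : enorm x <= norm1 x.
Proof.
rewrite -[leRHS]ger0_norm ?norm1_ge0// -sqrtr_sqr ler_wsqrtr//.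
rewrite expr2 {1}/norm1 mulr_suml ler_sum// => j _.
rewrite -real_normK ?num_real// expr2 ler_wpM2l// /norm1 (bigD1 j)//= lerDl.
by rewrite sumr_ge0.
Qed.

Lemma coord_le_norm x j : `|x ord0 j| <= `|x|.
Proof.
rewrite [leRHS]/Num.norm/= mx_normrE.
exact: (le_bigmax _ (fun ij => `|x ij.1 ij.2|) (ord0, j)).
Qed.

Lemma norm1_le_norm x : norm1 x <= m%:R * `|x|.
Proof.
apply: (@le_trans _ _ (\sum_(j < m) `|x|)).
  by apply: ler_sum => j _; exact: coord_le_norm.
by rewrite sumr_const card_ord mulr_natl.
Qed.

Lemma lipschitz_norm1 (L : R) g : lipschitz_fun L g ->
  forall x y, `|g x - g y| <= `|L| * norm1 (x - y).
Proof.
move=> gL x y; apply: le_trans (gL x y) _.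
apply: le_trans (ler_wpM2r (sqrtr_ge0 _) (ler_norm L)) _.
by rewrite ler_wpM2l// enorm_le_norm1.
Qed.

Lemma lipschitz_gradient_norm1 (L : R) g : smooth_fun L g ->
  forall j x y, `|'D_(delta_mx ord0 j) g x - 'D_(delta_mx ord0 j) g y| <=
    `|L| * norm1 (x - y).
Proof.
move=> [_ gL] j x y.
have := coord_le_enorm (gradient g x - gradient g y) j.
rewrite !mxE => /le_trans; apply; apply: le_trans (gL x y) _.
apply: le_trans (ler_wpM2r (sqrtr_ge0 _) (ler_norm L)) _.
by rewrite ler_wpM2l// enorm_le_norm1.
Qed.

Lemma lipschitz1_continuous g (K : R) :
  (forall x y, `|g x - g y| <= K * norm1 (x - y)) -> continuous g.
Proof.
move=> gK x.
apply: (proj2 (@cvgrPdist_le _ _ _ (nbhs x) (nbhs_filter x) g (g x))) => e e0.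
(* The factor [m] compares [norm1] with the sup norm that defines the topology; the [1] keeps [C]
   positive for the division. *)
pose C : R := `|K| * m%:R + 1.
have C0 : 0 < C by rewrite ltr_wpDl// mulr_ge0.
apply/(@nbhs_normP R 'rV[R]_m); exists (e / C) => [|y /ltW]; first by rewrite /= divr_gt0.
rewrite ler_pdivlMr// mulrC => xy.
apply: le_trans (gK x y) _; apply: (@le_trans _ _ (C * `|x - y|)).
  apply: (@le_trans _ _ (`|K| * (m%:R * `|x - y|))).
    apply: le_trans (ler_wpM2r (norm1_ge0 _) (ler_norm K)) _.
    by rewrite ler_wpM2l// norm1_le_norm.
  by rewrite mulrA ler_wpM2r// lerDl.
exact: xy.
Qed.

(** A basis vector has [norm1] equal to 1, so every difference quotient lies in [[-K, K]], and so
    does their limit. *)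
Lemma lipschitz_derive_le g (K : R) :
  (forall x y, `|g x - g y| <= K * norm1 (x - y)) ->
  (forall x, differentiable g x) ->
  forall j x, `|'D_(delta_mx ord0 j) g x| <= K.
Proof.
move=> gK dg j x.
have dgx : derivable g x (delta_mx ord0 j) by exact: diff_derivable.
have h (t : R) : t != 0 ->
    `|t^-1 *: ((g \o shift x) (t *: delta_mx ord0 j) - g x)| <= K.
  move=> t0; rewrite normrZ normfV ler_pdivrMl ?normr_gt0//.
  by apply: le_trans (gK _ _) _; rewrite /= addrK norm1Z norm1_delta mulr1 mulrC.
rewrite ler_norml; apply/andP; split.
- apply: limr_ge => //; near=> t.
  have /h : t != 0 by near: t; exact: nbhs_dnbhs_neq.
  by rewrite ler_norml => /andP[].
- apply: limr_le => //; near=> t.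
  have /h : t != 0 by near: t; exact: nbhs_dnbhs_neq.
  by rewrite ler_norml => /andP[].
Unshelve. all: by end_near. Qed.

Lemma is_derive_line g z h (t : R) : differentiable g (z + t *: h) ->
  is_derive t 1 (fun r => g (z + r *: h)) ('d g (z + t *: h) h).
Proof.
move=> dg.
have dc : is_diff t (fun r : R => z + r *: h) (fun r => r *: h).
  apply: is_diff_eq; apply/funext => r.
  by rewrite fctE/= add0r.
have dgc : is_diff (z + t *: h) g ('d g (z + t *: h)) by exact: differentiableP.
have dd : is_diff t (g \o (fun r : R => z + r *: h))
    ('d g (z + t *: h) \o (fun r => r *: h)) by exact: is_diff_comp.
apply: DeriveDef; first exact: diff_derivable.
by rewrite deriveE// diff_val /= scale1r.
Qed.

Lemma diff_coord g x h : differentiable g x ->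
  'd g x h = \sum_j h ord0 j * 'D_(delta_mx ord0 j) g x.
Proof.
move=> dg; rewrite {1}(row_sum_delta h) linear_sum; apply: eq_bigr => j _.
by rewrite linearZ deriveE.
Qed.

(** The mean value theorem on the segment from [z] to [z + h] turns the remainder into a difference
    of differentials at two points at most [norm1 h] apart, applied to [h]. *)
Lemma first_order_bound g (K : R) : (forall x, differentiable g x) ->
  (forall j x y, `|'D_(delta_mx ord0 j) g x - 'D_(delta_mx ord0 j) g y| <=
    K * norm1 (x - y)) ->
  forall z h, `|g (z + h) - g z - \sum_j h ord0 j * 'D_(delta_mx ord0 j) g z|
    <= K * norm1 h ^+ 2.
Proof.
move=> dg gK z h.
have dl (t : R) : is_derive t 1 (fun r : R => g (z + r *: h)) ('d g (z + t *: h) h).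
  exact: is_derive_line.
have [|c] := @MVT R (fun r => g (z + r *: h)) (fun t => 'd g (z + t *: h) h)
    0 1 ltr01 (fun t _ => dl t).
  apply: continuous_subspaceT => t.
  by apply/differentiable_continuous/derivable1_diffP; case: (dl t).
rewrite in_itv/= => /andP[c0 c1].
rewrite scale1r scale0r addr0 subr0 mulr1 => ->.
rewrite diff_coord// -sumrB; apply: le_trans (ler_norm_sum _ _ _) _.
rewrite expr2 mulrA [leRHS]mulrC {1}/norm1 mulr_suml ler_sum// => j _.
rewrite -mulrBr normrM ler_wpM2l//; apply: le_trans (gK _ _ _) _.
have K0 : 0 <= K.
  by have := le_trans (normr_ge0 _) (gK j (delta_mx ord0 j) 0); rewrite subr0 norm1_delta mulr1.
rewrite addrAC subrr add0r norm1Z ler_wpM2l// ler_piMl ?norm1_ge0//.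
by rewrite ger0_norm ltW.
Qed.

(** A quadratic remainder is [o(h)], so by uniqueness the linear form with coefficients [a] is the
    differential. It serves to differentiate the smoothed function from an integrated Taylor
    bound. *)
Lemma differentiable_first_order g (K : R) x (a : 'rV[R]_m) :
  (forall h, `|g (x + h) - g x - \sum_j h ord0 j * a ord0 j| <=
    K * norm1 h ^+ 2) ->
  differentiable g x /\ forall h, 'd g x h = \sum_j h ord0 j * a ord0 j.
Proof.
move=> gK.
pose A h : R := \sum_j h ord0 j * a ord0 j.
have A_lin : linear A.
  move=> t h k; rewrite /A scaler_sumr -big_split/=; apply: eq_bigr => j _.
  by rewrite !mxE mulrDl -mulrA.
pose AM := GRing.isLinear.Build _ _ _ _ _ A_lin.
pose AL : {linear _ -> _} := HB.pack A AM.
have cA : continuous (AL : _ -> _).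
  apply: (@lipschitz1_continuous _ (norm1 a)) => h k /=.
  rewrite /A -sumrB; apply: le_trans (ler_norm_sum _ _ _) _.
  rewrite mulrC {2}/norm1 mulr_suml ler_sum// => j _.
  rewrite -mulrBl normrM !mxE ler_wpM2l// /norm1 (bigD1 j)//= lerDl.
  by rewrite sumr_ge0.
have gA : g \o shift x = cst (g x) + A +o_ (0 : 'rV[R]_m) id.
  apply/eqaddoP => _/posnumP[e].
  pose C : R := `|K| * m%:R ^+ 2 + 1.
  have C0 : 0 < C by rewrite ltr_wpDl// mulr_ge0// sqr_ge0.
  near=> h.
  have -> : (g \o shift x - (cst (g x) + A)) h = g (x + h) - g x - A h.
    by rewrite !fctE/= opprD addrA [h + x]addrC.
  apply: le_trans (gK h) _.
  apply: (@le_trans _ _ (C * `|h| ^+ 2)).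
    apply: (@le_trans _ _ (`|K| * (m%:R * `|h|) ^+ 2)).
      apply: le_trans (ler_wpM2r (sqr_ge0 _) (ler_norm K)) _.
      by rewrite ler_wpM2l// lerXn2r ?nnegrE ?norm1_ge0 ?mulr_ge0// norm1_le_norm.
    by rewrite exprMn mulrA ler_wpM2r ?sqr_ge0// lerDl.
  rewrite expr2 mulrA ler_wpM2r// mulrC -ler_pdivlMr//.
  near: h; apply/(@nbhs_norm0P R 'rV[R]_m); exists (e%:num / C); first by rewrite /= divr_gt0.
  by move=> z /ltW.
have dE := diff_unique cA gA.
split; last by move=> h; rewrite dE.
by apply/diff_locallyP; rewrite dE.
Unshelve. all: by end_near. Qed.

End EuclideanBounds.

(** * The smoothed function *)

Lemma normr_Rintegral_le (R : realType) d (T : measurableType d)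
    (P : probability T R) (g : T -> R) (K : R) :
  P.-integrable setT (EFin \o g) -> (forall t, `|g t| <= K) ->
  `|Rintegral P setT g| <= K.
Proof.
move=> gi gK; apply: le_trans (le_normr_Rintegral measurableT gi) _.
have -> : K = Rintegral P setT (cst K).
  by rewrite /Rintegral (integral_probability_cst P K%:E).
apply: le_Rintegral => //; first exact: integrable_norm.
exact: finite_measure_integrable_cst.
Qed.

Section SmoothedFunction.
Context {R : realType} {N : nat} {n_ : 'I_N -> nat}.
Local Notation TR := (measurableTypeR R).
Local Notation gauss i := (@std_gaussian R (n_ i)).
Local Notation D_ j g x := ('D_(delta_mx ord0 j) g x).

Lemma ord_Rank (i : 'I_N) (c : 'I_(\sum_j n_ j)%N) :
  tagnat.sig1 c = i -> exists l : 'I_(n_ i), c = tagnat.Rank i l.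
Proof.
by move=> ci; move: (tagnat.sig2 c) (tagnat.sig2K c); rewrite ci => l <-; exists l.
Qed.

Lemma embed_blockE i (t : (n_ i).-tuple R) c :
  embed_block t ord0 c =
  if tagnat.sig1 c == i then nth 0 t (tagnat.sig2 c) else 0.
Proof. by rewrite mxE; case: ifP => _; rewrite mxE. Qed.

Lemma embed_block_rank i (t : (n_ i).-tuple R) (l : 'I_(n_ i)) :
  embed_block t ord0 (tagnat.Rank i l) = tnth t l.
Proof.
transitivity (submxrow (embed_block t) i ord0 l); first by rewrite [RHS]mxE.
by rewrite /embed_block mxrowK eqxx mxE (tnth_nth 0).
Qed.

Lemma measurable_nth n (k : nat) :
  measurable_fun setT (fun t : n.-tuple TR => nth 0 t k : TR).
Proof.
have [kn|nk] := ltnP k n.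
  rewrite (_ : (fun t : n.-tuple TR => _) = fun t => tnth t (Ordinal kn)).
    exact: measurable_tnth.
  by apply/funext => t; rewrite (tnth_nth 0).
rewrite (_ : (fun t : n.-tuple TR => _) = cst 0); first exact: measurable_cst.
by apply/funext => t; rewrite nth_default// size_tuple.
Qed.

Lemma measurable_embed_block i c :
  measurable_fun setT (fun t : (n_ i).-tuple TR => embed_block t ord0 c : R).
Proof.
under eq_fun do rewrite embed_blockE.
by case: (_ == i); [exact: measurable_nth|exact: measurable_cst].
Qed.

Lemma embed_block_le i (t : (n_ i).-tuple R) c :
  `|embed_block t ord0 c| <= \sum_l `|tnth t l|.
Proof.
have s0 : 0 <= \sum_l `|tnth t l| by rewrite sumr_ge0.
rewrite embed_blockE; case: ifP => _; last by rewrite normr0.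
(* The index is typed by the block of [c], so its bound by [n_ i] is tested rather than transported;
   out of range, [nth] returns the default 0. *)
have [kn|nk] := ltnP (tagnat.sig2 c) (n_ i); last first.
  by rewrite nth_default ?size_tuple// normr0.
rewrite -[nth _ _ _]/(nth 0 t (Ordinal kn)) -tnth_nth (bigD1 (Ordinal kn))//=.
by rewrite lerDl sumr_ge0.
Qed.

Lemma norm1_embed_block_le i (t : (n_ i).-tuple R) :
  norm1 (embed_block t) <= (\sum_j n_ j)%:R * \sum_l `|tnth t l|.
Proof.
apply: (@le_trans _ _ (\sum_(c < \sum_j n_ j) \sum_l `|tnth t l|)).
  by apply: ler_sum => c _; exact: embed_block_le.
by rewrite sumr_const card_ord mulr_natl.
Qed.

(** Coordinate lines of tuples become straight lines along basis vectors, which links partial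
    derivatives in [t] to directional derivatives of [f]. *)
Lemma embed_block_replace i (t : (n_ i).-tuple R) (l : 'I_(n_ i)) (b : R) :
  embed_block (replace_tnth l t b) =
  embed_block (replace_tnth l t 0) + b *: delta_mx ord0 (tagnat.Rank i l).
Proof.
apply/rowP => c; rewrite -(tagnat.sig2K c).
move: (tagnat.sig1 c) (tagnat.sig2 c) => j k.
have dE : (delta_mx ord0 (tagnat.Rank i l) : decision R n_) 0 (tagnat.Rank j k) =
    ((j == i) && (k == l :> nat))%:R :> R.
  by rewrite mxE eqxx -val_eqE tagnat.eq_Rank.
rewrite [RHS]mxE [X in _ + X]mxE dE.
have [ji|ji] := eqVneq j i; last first.
  have ki : (tagnat.sig1 (tagnat.Rank j k) == i) = false.
    by rewrite tagnat.Rank1K (negbTE ji).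
  by rewrite !embed_blockE ki mulr0 addr0.
subst j; rewrite !embed_block_rank !tnth_mktuple/= val_eqE.
by case: eqP => _; rewrite ?mulr1 ?add0r// mulr0 addr0.
Qed.

(** * Gaussian perturbations of a fixed point *)

Section Integrals.
Variables (mu : R) (i : 'I_N).
Implicit Types (g : decision R n_ -> R) (x : decision R n_).

Lemma measurable_perturbation g x : continuous g ->
  measurable_fun setT (fun t : (n_ i).-tuple TR => g (x + mu *: embed_block t)).
Proof.
move=> cg; apply: continuous_measurable_rV => // c.
rewrite (_ : (fun t => _) =
    fun t => x ord0 c + mu * embed_block t ord0 c); last first.
  by apply/funext => t; rewrite [LHS]mxE [X in _ + X]mxE.
apply: measurable_funD => //; apply: measurable_funM => //.
exact: measurable_embed_block.
Qed.

Lemma integrable_gaussian_linear n (F : n.-tuple TR -> R) (K : R) :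
  measurable_fun setT F ->
  (forall t, `|F t| <= K * (1 + \sum_l `|tnth t l|)) ->
  (@std_gaussian R n).-integrable setT (EFin \o F).
Proof.
move=> mF FK.
have K0 : 0 <= K.
  have := le_trans (normr_ge0 _) (FK [tuple 0 | _ < n]).
  by rewrite pmulr_lge0// ltr_pwDl// sumr_ge0.
apply: (@integrable_gaussian _ _ _ (K * n.+1%:R)) => // t.
apply: le_trans (FK t) _; rewrite -mulrA ler_wpM2l//.
have h : \sum_l `|tnth t l| <= \sum_l (1 + tnth t l ^+ 2).
  apply: ler_sum => l _; rewrite -(real_normK (num_real (tnth t l))).
  by have := sqr_ge0 (`|tnth t l| - 1); nra.
have S0 : 0 <= \sum_l tnth t l ^+ 2.
  by rewrite sumr_ge0// => l _; exact: sqr_ge0.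
rewrite big_split/= sumr_const card_ord in h.
rewrite -(natr1 n); have n0 : 0 <= n%:R :> R by [].
by nra.
Qed.

Lemma perturbation_le g (K : R) x (t : (n_ i).-tuple R) :
  (forall x y, `|g x - g y| <= K * norm1 (x - y)) ->
  `|g (x + mu *: embed_block t)| <=
  (`|g x| + `|K| * `|mu| * (\sum_j n_ j)%:R) * (1 + \sum_l `|tnth t l|).
Proof.
move=> gK; set S : R := \sum_l `|tnth t l|.
have S0 : 0 <= S by rewrite sumr_ge0.
have h : `|g (x + mu *: embed_block t) - g x| <=
    `|K| * `|mu| * (\sum_j n_ j)%:R * S.
  apply: le_trans (gK _ _) _; rewrite addrAC subrr add0r norm1Z.
  rewrite -!mulrA; apply: le_trans (ler_wpM2r _ (ler_norm K)) _.
    by rewrite mulr_ge0// norm1_ge0.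
  by rewrite !ler_wpM2l// norm1_embed_block_le.
have := lerD h (lexx `|g x|) => /(le_trans (ler_normD _ _)).
rewrite subrK => /le_trans; apply.
rewrite mulrDl addrC lerD//; first by rewrite ler_peMr// lerDl.
by rewrite ler_wpM2l ?mulr_ge0// lerDr.
Qed.

Lemma integrable_perturbation g (K : R) x :
  (forall x y, `|g x - g y| <= K * norm1 (x - y)) ->
  (gauss i).-integrable setT (fun t => (g (x + mu *: embed_block t))%:E).
Proof.
move=> gK; apply: integrable_gaussian_linear => [|t].
  by apply: measurable_perturbation; exact: lipschitz1_continuous gK.
exact: perturbation_le gK.
Qed.

Lemma Rintegral_sum I (s : seq I) d (T : measurableType d)
    (m : {measure set T -> \bar R}) (h : I -> T -> R) :
  (forall k, m.-integrable setT (EFin \o h k)) ->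
  Rintegral m setT (fun t => \sum_(k <- s) h k t) =
  \sum_(k <- s) Rintegral m setT (h k).
Proof.
move=> hi; rewrite /Rintegral.
under eq_integral do rewrite -sumEFin.
rewrite (integral_sum measurableT hi).
by rewrite sum_fine// => k _; exact: (integrable_fin_num measurableT (hi k)).
Qed.

Variables (f : decision R n_ -> R) (K0 K1 : R).
Hypothesis f_lip : forall x y, `|f x - f y| <= K0 * norm1 (x - y).
Hypothesis f_diff : forall x, differentiable f x.
Hypothesis df_lip : forall j x y, `|D_ j f x - D_ j f y| <= K1 * norm1 (x - y).

(** The candidate gradient of the smoothed function, with the derivatives taken under the
    integral. *)
Let G x : decision R n_ :=
  \row_j Rintegral (gauss i) setT (fun t => D_ j f (x + mu *: embed_block t)).

Let dfi j x := @integrable_perturbation ('D_(delta_mx ord0 j) f) K1 x (df_lip j).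
Let fi x := @integrable_perturbation f K0 x f_lip.

(** The first-order bound for [f] at [x + mu *: embed_block t] is uniform in [t], so it survives
    integration against a probability. *)
Let smoothed_first_order x h :
  `|smoothed f mu i (x + h) - smoothed f mu i x - \sum_j h ord0 j * G x ord0 j|
  <= K1 * norm1 h ^+ 2.
Proof.
have hi j : (gauss i).-integrable setT
    (EFin \o (fun t => h ord0 j * D_ j f (x + mu *: embed_block t))).
  exact: (integrableZl measurableT (h ord0 j) (dfi j x)).
have si : (gauss i).-integrable setT
    (EFin \o (fun t => \sum_j h ord0 j * D_ j f (x + mu *: embed_block t))).
  have := @integrable_sum _ _ _ _ _ measurableT _ (index_enum _) xpredT _
    (fun j _ => hi j).
  by apply: eq_integrable => // t _; rewrite /= sumEFin.
have bi : (gauss i).-integrable setT (EFin \o (fun t =>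
    f (x + h + mu *: embed_block t) - f (x + mu *: embed_block t))).
  by have := integrableB measurableT (fi (x + h)) (fi x).
have -> : \sum_j h ord0 j * G x ord0 j = Rintegral (gauss i) setT
    (fun t => \sum_j h ord0 j * D_ j f (x + mu *: embed_block t)).
  rewrite Rintegral_sum//; apply: eq_bigr => j _.
  by rewrite (RintegralZl _ measurableT (dfi j x)) /G mxE.
rewrite /smoothed -(RintegralB measurableT (fi (x + h)) (fi x)).
rewrite -(RintegralB measurableT bi si).
have ti := integrableB measurableT bi si.
apply: normr_Rintegral_le ti _ => t /=; rewrite [x + h + _]addrAC.
exact: first_order_bound.
Qed.

Lemma smoothed_differentiable x : differentiable (smoothed f mu i) x.
Proof. exact: (differentiable_first_order (smoothed_first_order x)).1. Qed.

Lemma smoothed_derive j x : D_ j (smoothed f mu i) x =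
  Rintegral (gauss i) setT (fun t => D_ j f (x + mu *: embed_block t)).
Proof.
have [ds dsE] := differentiable_first_order (smoothed_first_order x).
by rewrite deriveE// dsE sum_delta_mx /G mxE.
Qed.

(** Provides the continuity of the derivatives from which the partial gradient at the iterate is
    seen to be history-measurable. *)
Lemma smoothed_derive_lipschitz j x y :
  `|D_ j (smoothed f mu i) x - D_ j (smoothed f mu i) y| <= K1 * norm1 (x - y).
Proof.
rewrite !smoothed_derive -(RintegralB measurableT (dfi j x) (dfi j y)).
have ti := integrableB measurableT (dfi j x) (dfi j y).
apply: normr_Rintegral_le ti _ => t /=; apply: le_trans (df_lip _ _ _) _.
by rewrite opprD addrACA subrr addr0.
Qed.

Lemma smoothed_derive_le j x : `|D_ j (smoothed f mu i) x| <= K0.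
Proof.
rewrite smoothed_derive; apply: normr_Rintegral_le (dfi j x) _ => t.
exact: lipschitz_derive_le.
Qed.

Lemma partial_gradientE (g : decision R n_ -> R) x c :
  partial_gradient i g x ord0 c =
  if tagnat.sig1 c == i then D_ c g x else 0.
Proof.
rewrite mxE; case: ifP => _; rewrite mxE//.
by rewrite mxE tagnat.sig2K.
Qed.

(** Stein's identity for [t |-> f (x + mu *: embed_block t)], whose partial derivative carries the
    chain-rule factor [mu] that later cancels the division in the estimator. *)
Let stein_perturbation x (l : 'I_(n_ i)) :
  (\int[gauss i]_t (f (x + mu *: embed_block t) * tnth t l)%:E =
   (mu * D_ (tagnat.Rank i l) (smoothed f mu i) x)%:E)%E.
Proof.
(* The first summand is the growth constant of [perturbation_le], the second bounds the derivative;
   their sum meets both requirements of [stein_gaussian]. *)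
pose C := (`|f x| + `|K0| * `|mu| * (\sum_j n_ j)%:R) + `|mu| * `|K0|.
have pE (t : (n_ i).-tuple R) (b : R) :
    x + mu *: embed_block (replace_tnth l t b) =
    (x + mu *: embed_block (replace_tnth l t 0)) +
    b *: (mu *: delta_mx ord0 (tagnat.Rank i l)).
  by rewrite embed_block_replace scalerDr addrA !scalerA [b * mu]mulrC.
pose j := tagnat.Rank i l : 'I_(\sum_j n_ j).
transitivity (\int[gauss i]_t (mu * D_ j f (x + mu *: embed_block t))%:E)%E;
    last first.
  under eq_integral do rewrite EFinM.
  rewrite (integralZl measurableT (dfi j x)) smoothed_derive /Rintegral EFinM.
  by rewrite fineK//; exact: (integrable_fin_num measurableT (dfi j x)).
apply: (@stein_gaussian R _ l (fun t => f (x + mu *: embed_block t))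
  (fun t => mu * D_ j f (x + mu *: embed_block t)) C).
- exact: (measurable_perturbation x (lipschitz1_continuous f_lip)).
- apply: measurable_funM => //.
  exact: (measurable_perturbation x (lipschitz1_continuous (df_lip j))).
- move=> t b; under eq_fun do rewrite pE.
  apply: is_derive_eq; first by apply: is_derive_line; exact: f_diff.
  by rewrite -pE linearZ deriveE.
- move=> t; under eq_fun do rewrite pE.
  move=> b; apply: cvgM; first exact: cvg_cst.
  apply: (@cvg_comp _ _ _ (fun b : R => x + mu *: embed_block (replace_tnth l t 0)
    + b *: (mu *: delta_mx ord0 (tagnat.Rank i l))) ('D_(delta_mx ord0 j) f)); last first.
    exact: (lipschitz1_continuous (df_lip j)).
  by apply: cvgD; [exact: cvg_cst|exact: scalel_continuous].
- move=> t; apply: le_trans (perturbation_le _ _ f_lip) _.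
  by rewrite ler_wpM2r ?addr_ge0 ?sumr_ge0// lerDl mulr_ge0.
- move=> t; rewrite normrM /C; apply: (@le_trans _ _ (`|mu| * `|K0|)).
    rewrite ler_wpM2l//; apply: le_trans (ler_norm K0).
    exact: lipschitz_derive_le.
  by rewrite lerDr addr_ge0// !mulr_ge0.
Qed.

Let gaussian_mean (l : 'I_(n_ i)) : (\int[gauss i]_t (tnth t l)%:E = 0)%E.
Proof.
have := @stein_gaussian R (n_ i) l (cst 1) (cst 0) 1.
under eq_integral do rewrite mul1r.
rewrite integral0; apply => //.
- by move=> t b; exact: is_derive_cst.
- by move=> t b; exact: cvg_cst.
- by move=> t; rewrite normr1 mul1r lerDl sumr_ge0.
- by move=> t; rewrite normr0.
Qed.

(** Outside block [i] both sides vanish. Inside it, [b] multiplies a centred coordinate and drops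
    out, and [stein_perturbation] gives the rest. *)
Lemma residual_mean x (b : R) c : mu != 0 ->
  (\int[gauss i]_t
     ((f (x + mu *: embed_block t) - b) / mu * embed_block t ord0 c)%:E =
   (partial_gradient i (smoothed f mu i) x ord0 c)%:E)%E.
Proof.
move=> mu0; rewrite partial_gradientE; case: ifPn => [/eqP ci|ci]; last first.
  under eq_integral do rewrite embed_blockE (negbTE ci) mulr0.
  by rewrite integral0.
have [l ->] := ord_Rank ci.
pose Y t := f (x + mu *: embed_block t) * tnth t l.
have Yi : (gauss i).-integrable setT (fun t => (Y t)%:E).
  apply: (@integrable_gaussian_mul R _ l).
    exact: (measurable_perturbation x (lipschitz1_continuous f_lip)).
  by move=> t; exact: (perturbation_le _ _ f_lip).
have ti : (gauss i).-integrable setT (fun t => (tnth t l)%:E).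
  apply: (@integrable_gaussian_linear _ _ 1) => [|t]; first exact: measurable_tnth.
  rewrite mul1r ler_wpDl// (bigD1 l)//= lerDl.
  by rewrite sumr_ge0.
transitivity (\int[gauss i]_t (mu^-1%:E * (Y t)%:E - (b / mu)%:E * (tnth t l)%:E))%E.
  apply: eq_integral => t _; rewrite embed_block_rank -!EFinM -EFinB; congr EFin.
  by rewrite /Y; ring.
rewrite integralB//; [|exact: integrableZl..].
rewrite !integralZl// stein_perturbation gaussian_mean mule0 sube0 -EFinM.
by rewrite mulKf.
Qed.

End Integrals.
End SmoothedFunction.

(** * Integrals of functions of an independent variable *)

(** The existential form supplies an opaque measure known only through its values. *)
Lemma ex_pushforward_measure (R : realType) d1 d2 (T1 : measurableType d1)
    (T2 : measurableType d2) (m : {measure set T1 -> \bar R}) (phi : T1 -> T2) :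
  measurable_fun setT phi ->
  exists m' : {measure set T2 -> \bar R}, m' = pushforward m phi :> (set T2 -> \bar R).
Proof. by move=> mphi; unshelve eexists (pushforward m phi : {measure set T2 -> \bar R}). Qed.

Lemma ex_pushforward_finite_measure (R : realType) d1 d2 (T1 : measurableType d1)
    (T2 : measurableType d2) (m : {measure set T1 -> \bar R}) (phi : T1 -> T2) :
  measurable_fun setT phi -> fin_num_fun m ->
  exists m' : {finite_measure set T2 -> \bar R},
    m' = pushforward m phi :> (set T2 -> \bar R).
Proof.
move=> mphi mfin; have [m' m'E] := ex_pushforward_measure m mphi.
have m'oo : (m' setT < +oo)%E.
  by rewrite m'E ltey_eq /pushforward preimage_setT mfin.
(* Restricting to the whole space changes no value and provides the finite-measure structure. *)
exists (mfrestr measurableT m'oo : {finite_measure set T2 -> \bar R}).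
by apply/funext => A; rewrite -m'E -[A in RHS]setIT.
Qed.

Section ConditionalIndependence.
Context {R : realType} {d dS : measure_display}.
Context {T : measurableType d} {S : measurableType dS}.
Variables (P : probability T R) (E : set T) (mE : measurable E).
Variables (G : set_system T) (X : T -> S) (gamma : probability S R).
Hypothesis G_sub : <<s G >> `<=` measurable.
Hypothesis mX : measurable_fun setT X.
Hypothesis indep : forall H B, <<s G >> H -> measurable B ->
  P (H `&` E `&` X @^-1` B) = (P (H `&` E) * gamma B)%E.

Local Notation TG := (g_sigma_algebraType G).

(** The identity from [T] with its full sigma-algebra to [T] with the smaller one; its measurability
    is the inclusion [G_sub]. *)
Let idG : T -> TG := id.
Let midG : measurable_fun setT idG.
Proof. by move=> _ A mA; rewrite setTI; exact: G_sub. Qed.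

Let pairX (w : T) : TG * S := (w, X w).
Let mpairX : measurable_fun setT pairX.
Proof. exact: measurable_fun_pair. Qed.

(** The restriction of [P] to [E] has the indicator of [E] as density. *)
Let integral_mrestr (f : T -> \bar R) : measurable_fun setT f ->
  (forall w, 0 <= f w)%E ->
  (\int[mrestr P mE]_w f w = \int[P]_(w in E) f w)%E.
Proof.
move=> mf f0.
rewrite (@ge0_integral_density _ _ _ P (mrestr P mE) \1_E)//.
- rewrite [RHS]integral_mkcond; apply: eq_integral => w _.
  by rewrite patchE indicE; case: ifP; rewrite ?mule1 ?mule0.
- by move=> A mA; rewrite integral_indic// setIC.
Qed.

(** On [E], the joint law of [(w, X w)] is the product of the restriction of [P], seen on the small
    sigma-algebra, with [gamma]: by [indep] they agree on rectangles. Tonelli then integrates the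
    second variable first. *)
Lemma ge0_integral_independent (h : TG * S -> \bar R) :
  measurable_fun setT h -> (forall z, 0 <= h z)%E ->
  (\int[P]_(w in E) h (w, X w) = \int[P]_(w in E) \int[gamma]_t h (w, t))%E.
Proof.
move=> mh h0.
have mrestr_fin : fin_num_fun (mrestr P mE).
  move=> A mA; change (P (A `&` E) \is a fin_num).
  by apply: fin_num_measure; exact: measurableI.
have [nu nuE] := ex_pushforward_finite_measure midG mrestr_fin.
have [joint jointE] := ex_pushforward_measure (mrestr P mE) mpairX.
have mhX : measurable_fun setT (fun w => h (w, X w)).
  exact: (measurableT_comp mh mpairX).
rewrite -integral_mrestr//.
have -> : (\int[mrestr P mE]_w h (w, X w) = \int[joint]_z h z)%E.
  by rewrite jointE (ge0_integral_pushforward mpairX).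
have -> : (\int[joint]_z h z = \int[nu \x gamma]_z h z)%E.
  apply: eq_measure_integral => A mA _; apply/esym.
  apply: product_measure_unique => // B C mB mC.
  rewrite jointE; transitivity (P (B `&` E `&` X @^-1` C)).
    by congr (P _); apply/seteqP; split => w /=; tauto.
  rewrite indep//; congr (_ * _)%E.
  exact: (esym (congr1 (fun m => m B) nuE)).
rewrite fubini_tonelli1//.
have mF := measurable_fun_fubini_tonelli_F (m2 := gamma) h mh h0.
have F0 w : (0 <= fubini_F gamma h w)%E by exact: integral_ge0.
transitivity (\int[pushforward (mrestr P mE) idG]_w fubini_F gamma h w)%E.
  by apply: eq_measure_integral => A mA _; exact: (congr1 (fun m => m A) nuE).
rewrite (ge0_integral_pushforward midG)//.
apply: (integral_mrestr (f := fubini_F gamma h)) => //.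
exact: (measurableT_comp mF midG).
Qed.

Lemma integrable_independent (h : TG * S -> R) : measurable_fun setT h ->
  (\int[P]_(w in E) \int[gamma]_t `|h (w, t)|%:E < +oo)%E ->
  P.-integrable E (fun w => (h (w, X w))%:E).
Proof.
move=> mh hoo; apply/integrableP; split.
  apply/measurable_EFinP/measurable_funTS; exact: (measurableT_comp mh mpairX).
apply: le_lt_trans hoo; rewrite le_eqVlt; apply/predU1l.
rewrite -(@ge0_integral_independent (fun z => `|h z|%:E))//.
by apply/measurable_EFinP/measurableT_comp.
Qed.

Lemma integrable_independent_mul (A : TG -> R) (g : S -> R) :
  measurable_fun setT A -> measurable_fun setT g ->
  P.-integrable E (fun w => (A w)%:E) -> gamma.-integrable setT (EFin \o g) ->
  P.-integrable E (fun w => (A w * g (X w))%:E).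
Proof.
move=> mA mg iA ig.
apply: (@integrable_independent (fun z => A z.1 * g z.2)).
  by apply: measurable_funM; apply: measurableT_comp.
have igA : (gamma.-integrable setT (fun t => `|g t|%:E)) by exact: integrable_norm.
have iAA : (P.-integrable E (fun w => `|A w|%:E)) by exact: integrable_norm.
have E1 w : (\int[gamma]_t `|A w * g t|%:E =
    `|A w|%:E * \int[gamma]_t `|g t|%:E)%E.
  by rewrite -(integralZl measurableT igA); apply: eq_integral => t _;
    rewrite normrM EFinM.
under eq_integral do rewrite /= E1.
rewrite -(fineK (integrable_fin_num measurableT igA)) (integralZr mE iAA).
by rewrite -(fineK (integrable_fin_num mE iAA)) -EFinM ltry.
Qed.

Lemma integral_independent (h : TG * S -> R) : measurable_fun setT h ->
  P.-integrable E (fun w => (h (w, X w))%:E) ->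
  (\int[P]_(w in E) (h (w, X w))%:E =
   \int[P]_(w in E) \int[gamma]_t (h (w, t))%:E)%E.
Proof.
move=> mh ih.
have mEh : measurable_fun setT (EFin \o h) by exact/measurable_EFinP.
(* Integrability of the inner integrals of both parts is what allows their difference to be
   recombined into one integral. *)
have ge0_case (k : TG * S -> \bar R) : measurable_fun setT k ->
    (forall z, 0 <= k z)%E -> P.-integrable E (fun w => k (w, X w)) ->
    P.-integrable E (fun w => \int[gamma]_t k (w, t))%E.
  move=> mk k0 /integrableP[_ ik]; apply/integrableP; split.
    apply: measurable_funTS.
    have mF := measurable_fun_fubini_tonelli_F (m2 := gamma) k mk k0.
    exact: (measurableT_comp mF midG).
  apply: le_lt_trans ik; rewrite le_eqVlt; apply/predU1l.
  under eq_integral => w _ do rewrite gee0_abs ?integral_ge0//.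
  under [RHS]eq_integral => w _ do rewrite gee0_abs//.
  by rewrite ge0_integral_independent.
rewrite integralE.
have ip := integrable_funepos mE ih; have im := integrable_funeneg mE ih.
have mp := measurable_funepos mEh; have mm := measurable_funeneg mEh.
have pE : (fun w => (h (w, X w))%:E)^\+%E = fun w => (EFin \o h)^\+%E (w, X w).
  by apply/funext => w; rewrite !funeposE.
have nE : (fun w => (h (w, X w))%:E)^\-%E = fun w => (EFin \o h)^\-%E (w, X w).
  by apply/funext => w; rewrite !funenegE.
rewrite pE nE in ip im *.
rewrite !ge0_integral_independent// -integralB//; last 2 first.
- exact: ge0_case ip.
- exact: ge0_case im.
apply: eq_integral => w _; rewrite [RHS]integralE.
by congr (_ - _)%E; apply: eq_integral => t _; rewrite ?funeposE ?funenegE.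
Qed.

End ConditionalIndependence.

(** * The asynchronous iteration *)

Lemma integrable_law (R : realType) d dS (T : measurableType d)
    (S : measurableType dS) (P : probability T R) (gamma : probability S R)
    (X : T -> S) (g : S -> R) :
  measurable_fun setT X ->
  (forall B, measurable B -> P (X @^-1` B) = gamma B) ->
  gamma.-integrable setT (EFin \o g) ->
  P.-integrable setT (fun w => (g (X w))%:E).
Proof.
move=> mX XE /integrableP[mg goo]; apply/integrableP; split.
  exact: (measurableT_comp mg mX).
apply: le_lt_trans goo; rewrite le_eqVlt; apply/predU1l.
transitivity (\int[pushforward P X]_t `|(g t)%:E|)%E.
  by rewrite (ge0_integral_pushforward mX)//; exact: measurableT_comp.
by apply: eq_measure_integral => A mA _; exact: XE.
Qed.

Section BlockTuples.
Context {R : realType} {N : nat} {n_ : 'I_N -> nat}.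

Lemma tnth_block_tuple i (y : decision R n_) l :
  tnth (block_tuple i y) l = y ord0 (tagnat.Rank i l).
Proof. by rewrite tnth_mktuple mxE. Qed.

Lemma block_tupleK i (y : decision R n_) :
  (forall j, j != i -> submxrow y j = 0) -> embed_block (block_tuple i y) = y.
Proof.
move=> y0; rewrite -[RHS]submxrowK; apply: eq_mxrow => j.
case: eqVneq => [->|/y0 ->//]; apply/rowP => l.
by rewrite mxE -[LHS]/(nth 0 (block_tuple i y) l) -tnth_nth tnth_mktuple.
Qed.

Lemma measurable_block_tuple d (T : measurableType d) i (Y : T -> decision R n_) :
  (forall c, measurable_fun setT (fun w => Y w ord0 c)) ->
  measurable_fun setT
    (fun w => block_tuple i (Y w) : (n_ i).-tuple (measurableTypeR R)).
Proof.
move=> mY; apply/measurable_fun_tnthP => l.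
rewrite (_ : _ \o _ = fun w => Y w ord0 (tagnat.Rank i l)); first exact: mY.
by apply/funext => w; rewrite /= tnth_block_tuple.
Qed.

End BlockTuples.

Section CoordEvents.
Context {R : realType} {d : measure_display} {T : measurableType d}.

Lemma coord_events_sub m (X : T -> 'rV[R]_m) (F : set_system T) :
  coord_events X `<=` F <->
  forall c (B : set (measurableTypeR R)), measurable B ->
    F ((fun w => X w ord0 c) @^-1` B).
Proof.
split=> [XF c B mB|XF A [c _ [B mB <-]]]; last by rewrite setTI; exact: XF.
by apply: XF; exists c => //; exists B => //; rewrite setTI.
Qed.

End CoordEvents.

(** * Regularity of the iterates and conditional mean of the estimator *)

Section Dynamics.
Context {R : realType} {d : measure_display} {Omega : measurableType d}.
Context {N : nat} {n_ : 'I_N -> nat}.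
Variables (P : probability Omega R) (f : decision R n_ -> R) (K0 K1 : R).
Variables (alpha mu p : 'I_N -> R).
Variables (s : nat -> Omega -> 'I_N) (u : nat -> Omega -> decision R n_)
  (v : 'I_N -> Omega -> decision R n_) (x0 : decision R n_)
  (x : nat -> Omega -> decision R n_).
Hypothesis f_lip : forall y z, `|f y - f z| <= K0 * norm1 (y - z).
Hypothesis f_diff : forall y, differentiable f y.
Hypothesis df_lip : forall j y z,
  `|'D_(delta_mx ord0 j) f y - 'D_(delta_mx ord0 j) f z| <= K1 * norm1 (y - z).
Hypothesis mu_neq0 : forall i, mu i != 0.
Hypothesis sampling : async_sampling P p s u v.
Hypothesis iterates : forall w, residual_feedback_iterates f mu alpha x0
  (fun k => x k w) (fun k => u k w) (fun j => v j w) (fun k => s k w).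

Local Notation gauss i := (@std_gaussian R (n_ i)).

Let f_cont : continuous f := lipschitz1_continuous f_lip.

(** The generators of [history s u v k]: [TH k] is then [Omega] carrying the history sigma-algebra,
    and [hmeas k] is measurability with respect to it. *)
Let hgen k : set_system Omega :=
  (\bigcup_(i in [set: 'I_N]) coord_events (v i)) `|`
  (\bigcup_(m in `I_k)
    (range (fun i => [set w | s m w = i]) `|` coord_events (u m))).

Local Notation TH k := (g_sigma_algebraType (hgen k)).
Local Notation hmeas k g := (measurable_fun [set: TH k] (g : TH k -> R)).
Local Notation intg g := (P.-integrable setT (fun w => (g w)%:E)).
Local Notation event k i := [set w | s k w = i].
Local Notation prev i k w := (previous_value f mu
  (fun l => x l w) (fun l => u l w) (fun j => v j w) (fun l => s l w) i k).
Local Notation est i k w := (estimator f mu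
  (fun l => x l w) (fun l => u l w) (fun j => v j w) (fun l => s l w) i k).

Let history_sub k : history s u v k `<=` measurable.
Proof.
apply: smallest_sub; first exact: sigma_algebra_measurable.
move=> A [[i _]|[m _ [[i _ <-]|]]].
- exact: (initial_measurable sampling).
- exact: (selection_measurable sampling).
- exact: (direction_measurable sampling).
Qed.

Let mevent k i : measurable (event k i).
Proof. exact: (selection_measurable sampling). Qed.

Let history_mono m k : (m <= k)%N -> history s u v m `<=` history s u v k.
Proof.
move=> mk; apply: sub_sigma_algebra2 => A [|[l lm]]; first by left.
by right; exists l => //=; exact: leq_trans mk.
Qed.

Let hmeas_mono m k (g : Omega -> R) : (m <= k)%N -> hmeas m g -> hmeas k g.
Proof. by move=> mk mg _ B mB; apply: (history_mono mk); exact: mg. Qed.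

Let hmeas_measurable k (g : Omega -> R) : hmeas k g -> measurable_fun setT g.
Proof. by move=> mg _ B mB; apply: (@history_sub k); exact: mg. Qed.

Let hmeas_initial k i c : hmeas k (fun w => v i w ord0 c).
Proof.
move=> _ B mB; rewrite setTI; apply: sub_sigma_algebra; left; exists i => //.
by move: c B mB; apply/coord_events_sub.
Qed.

Let hmeas_direction m k c : (m < k)%N -> hmeas k (fun w => u m w ord0 c).
Proof.
move=> mk _ B mB; rewrite setTI; apply: sub_sigma_algebra; right.
exists m => //; right.
by move: c B mB; apply/coord_events_sub.
Qed.

Let history_event m k i : (m < k)%N -> history s u v k (event m i).
Proof.
by move=> mk; apply: sub_sigma_algebra; right; exists m => //; left; exists i.
Qed.

(** The acting agent is random; this reduces quantities indexed by [s k w] to fixed agents on the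
    events where they act. *)
Let select_sum k (g : 'I_N -> Omega -> R) w :
  g (s k w) w = \sum_i \1_(event k i) w * g i w.
Proof.
rewrite (bigD1 (s k w))//= big1 => [|i ik].
  by rewrite addr0 indicE mem_set// mul1r.
rewrite indicE memNset ?mul0r// => /= ki.
by rewrite ki eqxx in ik.
Qed.

(** The agent of step [k] enters the history from [k.+1] on, hence the shifted index. *)
Let hmeas_select k (g : 'I_N -> Omega -> R) : (forall i, hmeas k.+1 (g i)) ->
  hmeas k.+1 (fun w => g (s k w) w).
Proof.
move=> mg; rewrite (_ : (fun w => _) =
    fun w : TH k.+1 => \sum_i \1_(event k i) w * g i w); last first.
  by apply/funext => w; exact: select_sum.
apply: measurable_sum => i; apply: measurable_funM => //.
by apply: measurable_indic; exact: history_event.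
Qed.

Let integrable_select k (g : 'I_N -> Omega -> R) :
  (forall i, P.-integrable (event k i) (fun w => (g i w)%:E)) ->
  intg (fun w => g (s k w) w).
Proof.
move=> ig.
have := @integrable_sum _ _ _ P setT measurableT _ (index_enum 'I_N) xpredT
  (fun i => (fun w => (g i w)%:E) \_ (event k i))
  (fun i _ => (integrable_mkcond _ (mevent k i)).1 (ig i)).
apply: eq_integrable => // w _; rewrite select_sum -sumEFin.
apply: eq_bigr => i _; rewrite patchE indicE.
by case: ifP => _; rewrite ?mul1r// mul0r.
Qed.

Let X k i (w : Omega) : (n_ i).-tuple (measurableTypeR R) := block_tuple i (u k w).

Let measurable_direction k c : measurable_fun setT (fun w => u k w ord0 c).
Proof. exact: (hmeas_measurable (hmeas_direction c (ltnSn k))). Qed.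

Let mX k i : measurable_fun setT (X k i).
Proof. by apply: measurable_block_tuple => c; exact: measurable_direction. Qed.

Let XK k i w : s k w = i -> embed_block (X k i w) = u k w.
Proof.
move=> ki; apply: block_tupleK => j ji.
by apply: (direction_support sampling); rewrite ki.
Qed.

(** Intersecting the conditioning event with a history event keeps independence, so averaging over
    [H'] is again integration over a single event. *)
Let X_indep k i H' : history s u v k H' -> forall H B,
  history s u v k H -> measurable B ->
  P (H `&` (event k i `&` H') `&` X k i @^-1` B) =
  (P (H `&` (event k i `&` H')) * gauss i B)%E.
Proof.
move=> hH' H B hH mB.
have -> : H `&` (event k i `&` H') = (H `&` H') `&` event k i.
  by rewrite setIA setIAC.
apply: (direction_law sampling) => //.
exact: (@measurableI _ (TH k)).
Qed.

Let X_indepT k i H B : history s u v k H -> measurable B ->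
  P (H `&` event k i `&` X k i @^-1` B) = (P (H `&` event k i) * gauss i B)%E.
Proof. by move=> hH mB; exact: (direction_law sampling). Qed.

Let hmeas_comp k (g : decision R n_ -> R) (Z : Omega -> decision R n_) :
  continuous g -> (forall c, hmeas k (fun w => Z w ord0 c)) ->
  hmeas k (fun w => g (Z w)).
Proof. by move=> cg mZ; exact: (@continuous_measurable_rV _ _ (TH k)). Qed.

Let hmeas_perturb k (a : R) (Y Z : Omega -> decision R n_) :
  (forall c, hmeas k (fun w => Y w ord0 c)) ->
  (forall c, hmeas k (fun w => Z w ord0 c)) ->
  hmeas k (fun w => f (Y w + a *: Z w)).
Proof.
move=> mY mZ; apply: hmeas_comp => // c.
rewrite (_ : (fun w => _) = fun w : TH k => Y w ord0 c + a * Z w ord0 c).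
  by apply: measurable_funD => //; apply: measurable_funM.
by apply/funext => w; rewrite !mxE.
Qed.

Let integrable_comp (Z : Omega -> decision R n_) :
  (forall c, measurable_fun setT (fun w => Z w ord0 c)) ->
  (forall c, intg (fun w => Z w ord0 c)) -> intg (fun w => f (Z w)).
Proof.
move=> mZ iZ.
have iN : intg (fun w => norm1 (Z w)).
  have := @integrable_sum _ _ _ P setT measurableT _ (index_enum _) xpredT
    (fun c w => `|Z w ord0 c|%:E) (fun c _ => integrable_norm (iZ c)).
  by apply: eq_integrable => // w _; rewrite sumEFin.
have iB : intg (fun w => `|f 0| + `|K0| * norm1 (Z w)).
  under eq_fun do rewrite EFinD EFinM.
  apply: integrableD => //; first exact: finite_measure_integrable_cst.
  exact: (integrableZl measurableT `|K0| iN).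
apply: le_integrable iB => //.
  by apply/measurable_EFinP; exact: continuous_measurable_rV.
move=> w _; rewrite !abse_EFin lee_fin; apply: le_trans (ler_norm _).
rewrite -[X in f X]subr0 -[f _](subrK (f 0)) subr0 addrC.
apply: le_trans (ler_normD _ _) _; rewrite lerD2l.
apply: le_trans (f_lip _ _) _; rewrite subr0 ler_wpM2r ?norm1_ge0//.
exact: ler_norm.
Qed.

Let integrable_perturb (a : R) (Y Z : Omega -> decision R n_) :
  (forall c, measurable_fun setT (fun w => Y w ord0 c)) ->
  (forall c, measurable_fun setT (fun w => Z w ord0 c)) ->
  (forall c, intg (fun w => Y w ord0 c)) ->
  (forall c, intg (fun w => Z w ord0 c)) ->
  intg (fun w => f (Y w + a *: Z w)).
Proof.
move=> mY mZ iY iZ; apply: integrable_comp => c.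
  rewrite (_ : (fun w => _) = fun w => Y w ord0 c + a * Z w ord0 c).
    by apply: measurable_funD => //; apply: measurable_funM.
  by apply/funext => w; rewrite !mxE.
rewrite (_ : (fun w => _) =
    fun w => ((Y w ord0 c)%:E + a%:E * (Z w ord0 c)%:E)%E).
  apply: integrableD => //; exact: (integrableZl measurableT a (iZ c)).
by apply/funext => w; rewrite !mxE EFinD EFinM.
Qed.

Let integrable_embed_block i c :
  (gauss i).-integrable setT (fun t => (embed_block t ord0 c)%:E).
Proof.
apply: (@integrable_gaussian_linear _ _ _ 1) => [|t].
  exact: measurable_embed_block.
by rewrite mul1r; apply: le_trans (embed_block_le _ _) _; rewrite lerDr.
Qed.

Let integrable_initial i c : intg (fun w => v i w ord0 c).
Proof.
have mv c' : measurable_fun setT (fun w => v i w ord0 c').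
  exact: (hmeas_measurable (@hmeas_initial 0 i c')).
have vK w : embed_block (block_tuple i (v i w)) = v i w.
  by apply: block_tupleK => j ji; exact: (initial_support sampling).
under eq_fun do rewrite -vK.
apply: (@integrable_law _ _ _ _ _ P (gauss i) (fun w => block_tuple i (v i w))
  (fun t => embed_block t ord0 c)).
- exact: measurable_block_tuple.
- move=> B mB.
  (* To extract the law of [v i] from the joint law, take [B] at index [i] and the whole space
     elsewhere; the cast is needed because the type depends on [j]. *)
  pose B' j : set ((n_ j).-tuple (measurableTypeR R)) :=
    if pselect (j = i) is left e
    then eq_rect_r (fun j => set ((n_ j).-tuple (measurableTypeR R))) B e
    else setT.
  have B'i : B' i = B.
    rewrite /B'; case: pselect => // e.
    by rewrite (eq_irrelevance e erefl).
  have B'T j : j != i -> B' j = setT.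
    by move=> /eqP ji; rewrite /B'; case: pselect.
  have := initial_law sampling (B := B').
  rewrite (bigD1 i)//= big1 => [|j ji]; last first.
    by rewrite B'T//; exact: probability_setT.
  rewrite mule1 B'i => <-; last first.
    move=> j; have [->|ji] := eqVneq j i; first by rewrite B'i.
    by rewrite B'T.
  congr (P _); apply/seteqP; split => [w Bw j _|w /(_ i I)].
    have [->|ji] := eqVneq j i; first by rewrite /= B'i.
    by rewrite /= B'T.
  by rewrite /= B'i.
- exact: integrable_embed_block.
Qed.

Let integrable_event_mul k i (A : Omega -> R)
    (g : (n_ i).-tuple (measurableTypeR R) -> R) :
  hmeas k A -> measurable_fun setT g -> intg A ->
  (gauss i).-integrable setT (EFin \o g) ->
  P.-integrable (event k i) (fun w => (A w * g (X k i w))%:E).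
Proof.
move=> mA mg iA ig.
apply: (@integrable_independent_mul R _ _ Omega _ P (event k i) (mevent k i)
  (hgen k) (X k i) (gauss i)) => //.
- exact: (@history_sub k).
- exact: mX.
- by move=> H B; exact: X_indepT.
- exact: (integrableS measurableT (mevent k i)).
Qed.

Let integrable_direction k c : intg (fun w => u k w ord0 c).
Proof.
apply: (@integrable_select k (fun i w => u k w ord0 c)) => i.
have : P.-integrable (event k i)
    (fun w => (1 * embed_block (X k i w) ord0 c)%:E).
  apply: (@integrable_event_mul k i (cst 1) (fun t => embed_block t ord0 c)) => //.
  - exact: measurable_embed_block.
  - exact: finite_measure_integrable_cst.
  - exact: integrable_embed_block.
apply: eq_integrable => // w; rewrite inE/= => ki.
by rewrite mul1r XK.
Qed.

(** Step [k] heads the reversed list of the steps before [k.+1], so it is the latest one whenever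
    agent [i] acts there. *)
Let previous_valueS i k w : prev i k.+1 w =
  if s k w == i then f (x k w + mu i *: u k w) else prev i k w.
Proof.
rewrite /previous_value /last_selected -[k.+1]addn1 iotaD/= cats1 rev_rcons/=.
by rewrite add0n; case: ifP.
Qed.

Let estimatorE i k w c : est i k w ord0 c =
  (f (x k w + mu i *: u k w) - prev i k w) / mu i * u k w ord0 c.
Proof. by rewrite mxE. Qed.

Let x_first w : x 0 w = x0.
Proof. by have [] := iterates w. Qed.

Let x_next k w c :
  x k.+1 w ord0 c = x k w ord0 c - alpha (s k w) * est (s k w) k w ord0 c.
Proof. by have [_ ->] := iterates w; rewrite [LHS]mxE [X in _ + X]mxE [X in - X]mxE. Qed.

Let integrable_increment i c : (gauss i).-integrable setT
  (fun t => (norm1 (embed_block t) * embed_block t ord0 c)%:E).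
Proof.
have mn : measurable_fun setT (fun t => norm1 (@embed_block R N n_ i t)).
  apply: measurable_sum => j; apply: measurableT_comp => //.
  exact: measurable_embed_block.
have [ci|ci] := eqVneq (tagnat.sig1 c) i; last first.
  under eq_fun do rewrite embed_blockE (negbTE ci) mulr0.
  exact: finite_measure_integrable_cst.
have [l ->] := ord_Rank ci.
under eq_fun do rewrite embed_block_rank.
apply: (@integrable_gaussian_mul R _ l _ (\sum_j n_ j)%:R) => // t.
rewrite ger0_norm ?norm1_ge0//; apply: le_trans (norm1_embed_block_le _) _.
by rewrite ler_wpM2l// lerDr.
Qed.

(** Split the residual as [f x - b] plus [f (x + mu u) - f x]. The first part is history-measurable
    and multiplies an independent Gaussian; the second is at most [|K0| * |mu| * norm1 u], so [mu]
    cancels and [integrable_increment] applies. *)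
Let integrable_estimator k i c :
  (forall c, hmeas k (fun w => x k w ord0 c)) ->
  (forall c, intg (fun w => x k w ord0 c)) ->
  hmeas k (fun w => prev i k w) -> intg (fun w => prev i k w) ->
  P.-integrable (event k i) (fun w => (est i k w ord0 c)%:E).
Proof.
move=> mx ix mp ip.
have mfx : hmeas k (fun w => f (x k w)) by exact: hmeas_comp.
have ifx : intg (fun w => f (x k w)).
  by apply: integrable_comp => // c'; exact: hmeas_measurable (mx c').
have mE : measurable_fun setT (fun w => est i k w ord0 c).
  rewrite (_ : (fun w => _) = fun w =>
      (f (x k w + mu i *: u k w) - prev i k w) / mu i * u k w ord0 c).
    apply: measurable_funM; last exact: measurable_direction.
    apply: measurable_funM => //; apply: measurable_funB.
      apply: (@hmeas_measurable k.+1); apply: hmeas_perturb => c'.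
        exact: hmeas_mono (mx c').
      exact: hmeas_direction.
    exact: hmeas_measurable mp.
  by apply/funext => w; exact: estimatorE.
have i1 : P.-integrable (event k i)
    (fun w => ((f (x k w) - prev i k w) / mu i * embed_block (X k i w) ord0 c)%:E).
  apply: (@integrable_event_mul k i (fun w => (f (x k w) - prev i k w) / mu i)
    (fun t => embed_block t ord0 c)) => //.
  - by apply: measurable_funM => //; exact: measurable_funB.
  - exact: measurable_embed_block.
  - under eq_fun do rewrite mulrC EFinM EFinB.
    by apply: integrableZl => //; exact: integrableB.
  - exact: integrable_embed_block.
have i2 : P.-integrable (event k i) (fun w => (`|K0| *
    (norm1 (embed_block (X k i w)) * embed_block (X k i w) ord0 c))%:E).
  apply: (@integrable_event_mul k i (cst `|K0|)
    (fun t => norm1 (embed_block t) * embed_block t ord0 c)) => //.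
  - apply/measurable_EFinP; exact: (measurable_int _ (integrable_increment i c)).
  - exact: finite_measure_integrable_cst.
  - exact: integrable_increment.
have := integrableD (mevent k i) (integrable_abse i1) (integrable_abse i2).
apply: le_integrable => //.
  by apply/measurable_EFinP; exact: measurable_funTS.
move=> w ki; rewrite /= lee_fin.
apply: le_trans (ler_norm _); rewrite estimatorE (XK ki).
set U := u k w ord0 c; set b := prev i k w.
have -> : (f (x k w + mu i *: u k w) - b) / mu i * U =
    (f (x k w) - b) / mu i * U +
    (f (x k w + mu i *: u k w) - f (x k w)) / mu i * U by ring.
apply: le_trans (ler_normD _ _) _; rewrite lerD2l.
rewrite mulrA !normrM normr_id normfV ler_wpM2r//.
rewrite ler_pdivrMr ?normr_gt0//.
apply: le_trans (f_lip _ _) _; rewrite addrAC subrr add0r norm1Z.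
rewrite (ger0_norm (norm1_ge0 _)) -mulrA [_ * `|mu i|]mulrC.
by rewrite ler_wpM2r ?mulr_ge0 ?norm1_ge0// ler_norm.
Qed.

Let hmeas_estimator k i c :
  (forall c, hmeas k (fun w => x k w ord0 c)) ->
  hmeas k (fun w => prev i k w) ->
  hmeas k.+1 (fun w => est i k w ord0 c).
Proof.
move=> mx mp.
rewrite (_ : (fun w => _) = fun w : TH k.+1 =>
    (f (x k w + mu i *: u k w) - prev i k w) / mu i * u k w ord0 c); last first.
  by apply/funext => w; exact: estimatorE.
apply: measurable_funM; last exact: hmeas_direction.
apply: measurable_funM => //; apply: measurable_funB.
  apply: hmeas_perturb => c'; first exact: hmeas_mono (mx c').
  exact: hmeas_direction.
exact: hmeas_mono mp.
Qed.

(** The four properties are proved together: the next iterate needs the estimator, hence the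
    previous value, and the next previous value needs the current iterate. *)
Let iterate_regular k :
  [/\ forall c, hmeas k (fun w => x k w ord0 c),
      forall c, intg (fun w => x k w ord0 c),
      forall i, hmeas k (fun w => prev i k w) &
      forall i, intg (fun w => prev i k w)].
Proof.
elim: k => [|k [mx ix mp ip]].
  have mx0 c : hmeas 0 (fun w => x 0 w ord0 c).
    by under eq_fun do rewrite x_first; exact: measurable_cst.
  have ix0 c : intg (fun w => x 0 w ord0 c).
    by under eq_fun do rewrite x_first; exact: finite_measure_integrable_cst.
  (* No step precedes step 0, so the previous value is the one queried along the initial direction
     [v i]. *)
  split => // i.
  - by apply: hmeas_perturb => // c; exact: hmeas_initial.
  - apply: (@integrable_perturb (mu i) (x 0) (v i)) => // c.
    + exact: hmeas_measurable (mx0 c).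
    + exact: hmeas_measurable (@hmeas_initial 0 i c).
have mxS c : hmeas k.+1 (fun w => x k w ord0 c) by exact: hmeas_mono (mx c).
split => [c|c|i|i].
- under eq_fun do rewrite x_next.
  apply: (@hmeas_select k
    (fun i w => x k w ord0 c - alpha i * est i k w ord0 c)) => i.
  apply: measurable_funB => //; apply: measurable_funM => //.
  exact: hmeas_estimator.
- under eq_fun do rewrite x_next.
  apply: (@integrable_select k
    (fun i w => x k w ord0 c - alpha i * est i k w ord0 c)) => i.
  have xE := integrableS measurableT (mevent k i) (@subsetT _ _) (ix c).
  have eE := integrable_estimator c mx ix (mp i) (ip i).
  exact: (integrableB (mevent k i) xE (integrableZl (mevent k i) (alpha i) eE)).
- under eq_fun do rewrite previous_valueS.
  apply: (@hmeas_select k (fun j w =>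
    if j == i then f (x k w + mu i *: u k w) else prev i k w)) => j.
  case: (j == i); last exact: hmeas_mono (mp i).
  by apply: hmeas_perturb => // c; exact: hmeas_direction.
- under eq_fun do rewrite previous_valueS.
  apply: (@integrable_select k (fun j w =>
    if j == i then f (x k w + mu i *: u k w) else prev i k w)) => j.
  apply: (integrableS measurableT) => //.
  case: (j == i); last exact: ip.
  apply: integrable_perturb => // c; exact: hmeas_measurable (mx c).
Qed.

Lemma residual_feedback_cond_expectation i k :
  is_cond_expectation P (event k i) (history s u v k) (fun w => est i k w)
    (fun w => partial_gradient i (smoothed f (mu i) i) (x k w)).
Proof.
have [mx ix mp ip] := iterate_regular k.
have mY c : hmeas k
    (fun w => partial_gradient i (smoothed f (mu i) i) (x k w) ord0 c).
  under eq_fun do rewrite partial_gradientE.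
  case: (_ == i); last exact: measurable_cst.
  apply: (@hmeas_comp k ('D_(delta_mx ord0 c) (smoothed f (mu i) i))) => //.
  exact: lipschitz1_continuous (smoothed_derive_lipschitz _ _ f_lip f_diff df_lip c).
split=> [|c].
  apply/coord_events_sub => c B mB.
  by rewrite -[X in history _ _ _ _ X]setTI; exact: (mY c).
have iE := integrable_estimator c mx ix (mp i) (ip i).
split => //.
  apply: (integrableS measurableT) => //; apply: measurable_bounded_integrable => //.
  - by rewrite (le_lt_trans (probability_le1 _ _))// ltry.
  - exact: hmeas_measurable (mY c).
  (* The Lipschitz constant of [f] bounds every derivative of the smoothed function, so the partial
     gradient is bounded. *)
  - exists `|K0|; split => // M KM w _ /=; rewrite partial_gradientE.
    apply/ltW/le_lt_trans/KM; case: ifP => _; last by rewrite normr0.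
    apply: le_trans (smoothed_derive_le _ _ f_lip f_diff df_lip _ _) (ler_norm _).
move=> H hH.
have mEH : measurable (event k i `&` H).
  by apply: measurableI => //; exact: (@history_sub k).
(* The estimator with its two sources of randomness separated: the history point [z.1] and the fresh
   Gaussian block [z.2]. *)
pose h (z : TH k * (n_ i).-tuple (measurableTypeR R)) : R :=
  (f (x k z.1 + mu i *: embed_block z.2) - prev i k z.1) / mu i *
  embed_block z.2 ord0 c.
have mh : measurable_fun setT h.
  have me c' : measurable_fun setT
      (fun z : TH k * (n_ i).-tuple (measurableTypeR R) =>
        embed_block z.2 ord0 c' : R).
    exact: (measurableT_comp (measurable_embed_block c') (@measurable_snd _ _ _ _)).
  apply: measurable_funM => //; apply: measurable_funM => //.
  apply: measurable_funB; last exact: (measurableT_comp (mp i) (@measurable_fst _ _ _ _)).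
  apply: continuous_measurable_rV => // c'.
  rewrite (_ : (fun z => _) =
    fun z => x k z.1 ord0 c' + mu i * embed_block z.2 ord0 c'); last first.
    by apply/funext => z; rewrite [LHS]mxE [X in _ + X]mxE.
  apply: measurable_funD; first exact: (measurableT_comp (mx c') (@measurable_fst _ _ _ _)).
  exact: measurable_funM.
have hE w : (event k i `&` H) w -> est i k w ord0 c = h (w, X k i w).
  by move=> [ki _]; rewrite estimatorE /h/= XK.
transitivity (\int[P]_(w in event k i `&` H) (h (w, X k i w))%:E)%E.
  by apply: eq_integral => w; rewrite inE => wE; rewrite hE.
have ih : P.-integrable (event k i `&` H) (fun w => (h (w, X k i w))%:E).
  have := integrableS (mevent k i) mEH (@subIsetl _ _ _) iE.
  by apply: eq_integrable => // w; rewrite inE => wE; rewrite hE.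
rewrite (@integral_independent R _ _ Omega _ P _ mEH (hgen k) (X k i) (gauss i)
  (@history_sub k) (@mX k i) (@X_indep k i H hH) h mh ih).
(* For fixed [w] the iterate and the previous value are constants, and the inner Gaussian integral
   is that of [residual_mean]. *)
apply: eq_integral => w _.
exact: (residual_mean i f_lip f_diff df_lip (x k w) (prev i k w) c (mu_neq0 i)).
Qed.

End Dynamics.

Unset Implicit Arguments.

(** Differentiability is asserted too because [gradient] collects directional derivatives, which
    form a genuine gradient when the function is differentiable. *)
Theorem lemma3
  (R : realType) (d : measure_display) (Omega : measurableType d)
  (P : probability Omega R)
  (N : nat) (n_ : 'I_N -> nat)
  (f : decision R n_ -> R) (L0 L1 : R)
  (f_bounded_below : has_lbound (range f))
  (f_lipschitz : lipschitz_fun L0 f)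
  (f_smooth : smooth_fun L1 f)
  (alpha mu p : 'I_N -> R)
  (alpha_gt0 : forall i, 0 < alpha i)
  (mu_gt0 : forall i, 0 < mu i)
  (p_ge0 : forall i, 0 <= p i)
  (p_sum1 : \sum_i p i = 1)
  (s : nat -> Omega -> 'I_N)
  (u : nat -> Omega -> decision R n_)
  (v : 'I_N -> Omega -> decision R n_)
  (sampling : async_sampling P p s u v)
  (x0 : decision R n_)
  (x : nat -> Omega -> decision R n_)
  (iterates : forall w, residual_feedback_iterates f mu alpha x0
     (fun k => x k w) (fun k => u k w) (fun j => v j w) (fun k => s k w))
  (i : 'I_N) (k : nat) :
  (forall y, differentiable (smoothed f (mu i) i) y) /\
  is_cond_expectation P [set w | s k w = i] (history s u v k)
    (fun w => estimator f mu
       (fun l => x l w) (fun l => u l w) (fun j => v j w) (fun l => s l w) i k)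
    (fun w => partial_gradient i (smoothed f (mu i) i) (x k w)).
Proof.
have f_lip := lipschitz_norm1 f_lipschitz.
have df_lip := lipschitz_gradient_norm1 f_smooth.
have [f_diff _] := f_smooth.
split=> [y|].
  exact: (smoothed_differentiable (mu i) i f_lip f_diff df_lip).
have mu_neq0 j : mu j != 0 by rewrite gt_eqF.
exact: (residual_feedback_cond_expectation f_lip f_diff df_lip mu_neq0 sampling
  iterates).
Qed.
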